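(* There exists an increasing sequence of positive integers $(n_l)$ whose set of terms has density $1$ such that $$\lim_{l\to\infty}\mathbb{P}\left(\chi_{n_l} = 2^{n_l-\lfloor \log n_l+\log\log n_l\rfloor}\right)= 1.$$
   Context: All logarithms are base $2$. For a positive integer $n$, the random Cayley sum graph on $\mathbb{F}_2^n$ is constructed as follows: choose a random subset $A\subset\mathbb{F}_2^n$ by including each element independently with probability $\frac12$; the graph has vertex set $\mathbb{F}_2^n$, and distinct vertices $x\neq y$ are adjacent if and only if $x+y\in A$. $\chi_n$ denotes the chromatic number of this random graph. The density of a set $S\subset\mathbb{N}$ is $d(S)=\lim_{n\to\infty}|S\cap\{1,\dots,n\}|/n$. *)

(* Defs.v *)
From HB Require Import structures.
From mathcomp Require Import all_boot all_order all_algebra.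
From mathcomp Require Import all_classical all_reals all_analysis.

Set Implicit Arguments.
Unset Strict Implicit.
Unset Printing Implicit Defensive.

Import Order.TTheory GRing.Theory Num.Theory.
Import numFieldNormedType.Exports.

Local Open Scope classical_set_scope.
Local Open Scope ring_scope.

Record sgraph (V : finType) := SGraph {
  adj :> rel V;
  adj_sym : symmetric adj;
  adj_irrefl : irreflexive adj }.

Definition proper_coloring (V : finType) (G : sgraph V) (k : nat)
    (c : {ffun V -> 'I_k}) : bool :=
  [forall x, forall y, G x y ==> (c x != c y)].

Definition colorable (V : finType) (G : sgraph V) (k : nat) : bool :=
  [exists c : {ffun V -> 'I_k}, proper_coloring G c].

Lemma ex_colorable (V : finType) (G : sgraph V) : exists k, colorable G k.
Proof.
exists #|V|; apply/existsP; exists [ffun x => enum_rank x].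
apply/forallP => x; apply/forallP => y; apply/implyP; rewrite !ffunE.
by apply: contraTneq => /enum_rank_inj ->; rewrite adj_irrefl.
Qed.

Definition chromatic_number (V : finType) (G : sgraph V) : nat :=
  ex_minn (ex_colorable G).

Definition cayley_sum_adj (n : nat) (A : {set 'rV['F_2]_n}) :
    rel 'rV['F_2]_n :=
  fun x y => (x != y) && (x + y \in A).

Lemma cayley_sum_adj_sym (n : nat) (A : {set 'rV['F_2]_n}) :
  symmetric (cayley_sum_adj A).
Proof. by move=> x y; rewrite /cayley_sum_adj eq_sym addrC. Qed.

Lemma cayley_sum_adj_irrefl (n : nat) (A : {set 'rV['F_2]_n}) :
  irreflexive (cayley_sum_adj A).
Proof. by move=> x; rewrite /cayley_sum_adj eqxx. Qed.

Definition cayley_sum_graph (n : nat) (A : {set 'rV['F_2]_n}) :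
    sgraph 'rV['F_2]_n :=
  SGraph (cayley_sum_adj_sym A) (cayley_sum_adj_irrefl A).

(* Law of the random subset of T that contains each element independently
   with probability p: the probability of an event E is the total mass of the
   outcomes A satisfying E, the mass of A being the product over x of the
   probability that x is in, resp. out, as A prescribes. *)
Definition random_subset_mass (R : realType) (T : finType) (p : R)
    (A : {set T}) : R :=
  \prod_(x : T) (if x \in A then p else 1 - p).

Definition random_subset_Pr (R : realType) (T : finType) (p : R)
    (E : pred {set T}) : R :=
  \sum_(A : {set T} | E A) random_subset_mass p A.

(* ln is 0 on nonpositive reals, so log2 (log2 1) = 0. *)
Definition log2 (R : realType) (x : R) : R := ln x / ln 2.

(* The value at n = 0 is a division by zero and is irrelevant to the limit. *)
Definition has_density (R : realType) (S : set nat) (d : R) : Prop :=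
  (fun n : nat => (count (fun k => k \in S) (iota 1 n))%:R / n%:R : R)
    @ \oo --> d.

(* Main.v *)
(** A set [X] is independent exactly when [X + X] misses [A] outside [0], and
cosets of an independent subspace are independent; so with [2 ^ k <= n log n <
2 ^ k.+1] it is enough that, with high probability, some [k]-dimensional
subspace is independent and no set of [2 ^ k + 1] points is.  The first is a
second moment computation over the graphs [{(u, u D)}] of matrices [D].

The second is a union bound: every [X] of size [2 ^ k + 1] must have a set
[F] in [X + X] with more elements than bits needed to describe it.  Let
[r = dim <X>], so that a basis costs [n r] bits.

If [r >= C log n], a greedy sample of [X] gives a set [P] of popular sums
of size [O(n r)] which contains most sums of each typical point; then, for
independent typical points [z_1, .., z_q], counting paths in the cube spanned
by the [z_i] produces more points of [X] in a coset of their span than a small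
subspace may contain.  If [r < C log n], the popular sums give bounded
doubling, and the Petridis and Ruzsa arguments put most of [X] in a subspace of
size [O(2 ^ k)], so [r <= k + O(1)].  In that last case Dyson's transform turns
[(X, X)] into [(A, B)] with [A + B] inside [X + X] and [|A| + |B| = 2 |X|]:
either [B] is small and a sparse sample of [A] already yields almost [|A|]
sums, or [A + B] is nearly a union of cosets of a large subgroup.  In both cases
[F] has about [2 ^ k.+1] elements, which exceeds [n k] by a constant factor
unless [n log n] is slightly below a power of two; such [n] have density zero. *)

Require Import Defs.
From HB Require Import structures.
From mathcomp Require Import all_boot all_order all_algebra all_field.
From mathcomp Require Import zify.
From mathcomp Require boolp.

Set Implicit Arguments.
Unset Strict Implicit.
Unset Printing Implicit Defensive.

Import Order.TTheory GRing.Theory Num.Theory.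

(** * Sumsets and popular sums *)

Lemma F2_cases (c : 'F_2) : (c = 0 \/ c = 1)%R.
Proof. by case: c => -[|[|//]] i; [left|right]; apply: val_inj. Qed.

(** Identities between sums of vectors, checked coordinate by coordinate over both values of every
    entry. *)
Ltac vec2 := let i := fresh "i" in apply/rowP => i; rewrite !mxE;
  repeat match goal with |- context [fun_of_matrix ?x 0%R i] =>
    case: (F2_cases (x 0%R i)) => -> end; by apply: val_inj.

Section Sumsets.
Variable n : nat.
Local Notation W := 'rV['F_2]_n.
Implicit Types (x y s : W) (A B C X Y E P : {set W}).

Lemma addvv x : (x + x = 0)%R.
Proof. by apply/rowP => i; rewrite !mxE; case: (F2_cases (x 0%R i)) => ->; apply: val_inj. Qed.

Lemma oppv x : (- x = x)%R.
Proof. by apply/eqP; rewrite eq_sym -subr_eq0 opprK addvv. Qed.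

Lemma addvK x y : (x + y + y = x)%R.
Proof. by rewrite -addrA addvv addr0. Qed.

Lemma addKv x y : (x + (x + y) = y)%R.
Proof. by rewrite addrA addvv add0r. Qed.

Lemma addv_eq0 x y : (x + y == 0)%R = (x == y).
Proof. by rewrite -{1}[y]oppv subr_eq0. Qed.

Definition sumset A B : {set W} := [set (a + b)%R | a in A, b in B].

Lemma sumsetP A B s :
  reflect (exists a b, [/\ a \in A, b \in B & s = (a + b)%R]) (s \in sumset A B).
Proof.
apply: (iffP imset2P) => [[a b aA bB ->]|[a [b [aA bB ->]]]]; first by exists a, b.
by exists a b.
Qed.

Lemma mem_sumset A B x y : x \in A -> y \in B -> (x + y)%R \in sumset A B.
Proof. by move=> xA yB; apply/sumsetP; exists x, y. Qed.

Lemma sumsetC A B : sumset A B = sumset B A.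
Proof.
by apply/setP => s; apply/sumsetP/sumsetP => -[a [b [? ? ->]]]; exists b, a; rewrite addrC.
Qed.

Lemma sumsetA A B C : sumset A (sumset B C) = sumset (sumset A B) C.
Proof.
apply/setP => s; apply/sumsetP/sumsetP.
  move=> [a [_ [aA /sumsetP[b [c [bB cC ->]]] ->]]].
  by exists (a + b)%R, c; rewrite mem_sumset // addrA.
move=> [_ [c [/sumsetP[a [b [aA bB ->]]] cC ->]]].
by exists a, (b + c)%R; rewrite mem_sumset // addrA.
Qed.

Lemma sumsetS A B C E : A \subset C -> B \subset E -> sumset A B \subset sumset C E.
Proof.
move=> /subsetP AC /subsetP BE; apply/subsetP => s /sumsetP[a [b [aA bB ->]]].
by rewrite mem_sumset ?AC ?BE.
Qed.

Definition translate x A : {set W} := [set (x + a)%R | a in A].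

Lemma mem_translate x A s : (s \in translate x A) = ((x + s)%R \in A).
Proof.
apply/imsetP/idP => [[a aA ->]|h]; first by rewrite addKv.
by exists (x + s)%R; rewrite ?addKv.
Qed.

Lemma card_translate x A : #|translate x A| = #|A|.
Proof. by rewrite card_imset //; apply: addrI. Qed.

Lemma sumset1 x A : sumset [set x] A = translate x A.
Proof.
apply/setP => s; apply/sumsetP/imsetP => [[a [b [/set1P -> bA ->]]]|[a aA ->]].
  by exists b.
by exists x, a; rewrite set11.
Qed.

Lemma sumset0 A : sumset set0 A = set0.
Proof. by apply/setP => s; rewrite inE; apply/negP => /sumsetP[a [b [/[!inE]]]]. Qed.

Lemma sumsetU1 x A B : sumset (x |: A) B = translate x B :|: sumset A B.
Proof.
apply/setP => s; rewrite inE mem_translate; apply/sumsetP/orP.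
  move=> [a [b [/setU1P[->|aA] bB ->]]]; first by left; rewrite addKv.
  by right; rewrite mem_sumset.
move=> [h|/sumsetP[a [b [aA bB ->]]]].
  by exists x, (x + s)%R; rewrite setU11 h addKv.
by exists a, b; rewrite inE aA orbT.
Qed.

(** The number of representations of [s] as [a + b]; in characteristic 2 the summand [s - b] is
    [s + b]. *)
Definition reps A B s := #|[set b in B | (s + b)%R \in A]|.

Lemma reps_sym A B s : reps A B s = #|[set a in A | (s + a)%R \in B]|.
Proof.
rewrite /reps -(card_translate s); apply: eq_card => a.
by rewrite mem_translate !inE addKv andbC.
Qed.

Lemma repsE A B s : reps A B s = \sum_(b in B) ((s + b)%R \in A).
Proof.
rewrite /reps -sum1_card big_mkcond [RHS]big_mkcond; apply: eq_bigr => b _.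
by rewrite inE; case: (b \in B) => //=; case: (_ \in A).
Qed.

Lemma reps_leq A B s : reps A B s <= #|B|.
Proof. by apply/subset_leq_card/subsetP => b; rewrite inE => /andP[]. Qed.

Lemma reps_gt0 A B s : (0 < reps A B s) = (s \in sumset A B).
Proof.
apply/card_gt0P/sumsetP => [[b]|[a [b [aA bB ->]]]].
  by rewrite inE => /andP[bB sA]; exists (s + b)%R, b; rewrite addvK.
by exists b; rewrite inE bB addvK.
Qed.

Lemma sum_reps_in A B P :
  \sum_(s in P) reps A B s = \sum_(a in A) #|translate a B :&: P|.
Proof.
under eq_bigr => s _ do rewrite reps_sym -sum1_card.
rewrite (exchange_big_dep (mem A)) /=; last by move=> s a _; rewrite inE => /andP[].
apply: eq_bigr => a aA; rewrite -sum1_card; apply: eq_bigl => s.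
by rewrite !inE mem_translate aA andTb andbC addrC.
Qed.

Lemma sum_reps A B : \sum_s reps A B s = #|A| * #|B|.
Proof.
transitivity (\sum_(s in [set: W]) reps A B s); first by apply: eq_bigl => s; rewrite inE.
rewrite sum_reps_in -sum_nat_const; apply: eq_bigr => a _.
by rewrite setIT card_translate.
Qed.

Lemma ex_ge_mean (T : finType) (A : {set T}) (F : T -> nat) (c : nat) :
  A != set0 -> c <= \sum_(a in A) F a -> exists2 a, a \in A & c <= #|A| * F a.
Proof.
move=> /set0Pn[a0 a0A] h; case: (arg_maxnP F a0A) => a aA amax.
exists a => //; apply: leq_trans h _; rewrite -sum_nat_const.
by apply: leq_sum => b /amax.
Qed.

(** Summed over [a], the new elements of [a + B] count the pairs whose sum avoids [C]. Sums in [C]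
    carry at most [t |C|] of the capped count, and some [a] reaches the mean. *)
Lemma greedy_step A B C t :
  A != set0 -> exists2 a, a \in A &
    \sum_s minn (reps A B s) t - t * #|C| <= #|A| * #|translate a B :\: C|.
Proof.
move=> A0; apply: ex_ge_mean => //.
have -> : \sum_(a in A) #|translate a B :\: C| = \sum_(s in ~: C) reps A B s.
  by rewrite sum_reps_in; apply: eq_bigr => a _; rewrite setDE.
rewrite (bigID (mem C)) /= leq_subLR leq_add //.
  rewrite mulnC -sum_nat_const; apply: leq_sum => s _; exact: geq_minr.
rewrite [X in _ <= X](eq_bigl (fun s => s \notin C)); last by move=> s; rewrite inE.
by apply: leq_sum => s _; apply: geq_minl.
Qed.

(* Greedy covering: while [Y + B] has fewer than [c] elements, a translate
   [a + B] chosen by averaging contributes at least [(Phi - t c) / |A|] new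
   sums, where [Phi] is the number of pairs counted with multiplicity capped at
   [t]. *)
Lemma greedy_sumset A B t m c :
  A != set0 -> #|A| * c <= m * (\sum_s minn (reps A B s) t - t * c) ->
  exists Y, [/\ Y \subset A, #|Y| <= m & c <= #|sumset Y B|].
Proof.
set Phi := \sum_s _ => A0 h.
suff [Y [YA Ym]] : exists Y, [/\ Y \subset A, #|Y| <= m &
    (c <= #|sumset Y B|) || (m * (Phi - t * c) <= #|A| * #|sumset Y B|)].
  move=> cov; exists Y; split=> //; case/orP: cov => // cov.
  by rewrite -(@leq_pmul2l #|A|) ?card_gt0 // (leq_trans h).
elim: m {h} => [|m [Y [YA Ym cov]]].
  by exists set0; rewrite sub0set cards0 mul0n leq0n orbT.
have [cY|cY] := leqP c #|sumset Y B|; first by exists Y; rewrite cY; split=> //; apply: leqW.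
rewrite leqNgt cY /= in cov.
have [a aA new] := greedy_step B (sumset Y B) t A0.
exists (a |: Y); split; first by rewrite subUset sub1set aA.
  by rewrite (leq_trans (leq_card_setU _ _)) // cards1.
apply/orP; right; rewrite sumsetU1 setUC.
have -> : sumset Y B :|: translate a B = sumset Y B :|: (translate a B :\: sumset Y B).
  by rewrite setDE setUIr setUCr setIT.
rewrite cardsU disjoint_setI0; last by rewrite disjoints_subset setDE; apply/subsetP => s sY; rewrite !inE sY /= andbF.
rewrite cards0 subn0 mulnDr mulSn addnC leq_add //.
apply: leq_trans new; apply: leq_sub2l; rewrite leq_mul2l; apply/orP; right; exact: ltnW.
Qed.

(* Adding to [B] an element [x] with at least [a] unpopular partners raises the
   capped count [\sum_s minn (reps X B s) t] by at least [a]. *)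
Lemma popular_sums X m t a :
  exists B, [/\ B \subset X, #|B| <= m &
    (m * a <= \sum_s minn (reps X B s) t) \/
    (forall x, x \in X :\: B ->
      #|[set x' in X | reps X B (x + x')%R < t]| < a)].
Proof.
elim: m => [|m [B [BX By [cov|sparse]]]].
- by exists set0; rewrite sub0set cards0; split=> //; left.
- have [/existsP[x /andP[xXB xa]]|/existsPn h] :=
    boolP [exists x, (x \in X :\: B) && (a <= #|[set x' in X | reps X B (x + x')%R < t]|)];
    last first.
    exists B; split=> //; first exact: leqW.
    by right=> x xXB; have := h x; rewrite xXB /= -ltnNge.
  move: xXB; rewrite inE => /andP[xB xX].
  exists (x |: B); split; first by rewrite subUset sub1set xX.
    by rewrite cardsU1 xB.
  left; rewrite mulSn addnC (leq_trans (leq_add cov xa)) //.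
  rewrite -(card_translate x) -sum1_card [X in _ + X]big_mkcond -big_split /=.
  apply: leq_sum => s _.
  have -> : reps X (x |: B) s = ((s + x)%R \in X) + reps X B s.
    by rewrite !repsE big_setU1.
  rewrite mem_translate inE addKv addrC.
  case: (_ \in X) => //=; case: ltnP => //; lia.
- by exists B; split=> //; [apply: leqW | right].
Qed.

End Sumsets.

(** * Subspaces, Dyson's transform, Petridis and Ruzsa *)

Section Subspaces.
Variable n : nat.
Local Notation W := 'rV['F_2]_n.
Implicit Types (x y s : W) (A B C X Y Z E P : {set W}) (U : {vspace W}).

Definition vset U : {set W} := [set x | x \in U].

Definition sspan X : {vspace W} := <<enum X>>%VS.

Lemma card_vset U : #|vset U| = 2 ^ \dim U.
Proof. by rewrite cardsE (card_vspace (T := W) U) card_Fp. Qed.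

Lemma mem_sspan X x : x \in X -> x \in sspan X.
Proof. by move=> xX; rewrite memv_span // mem_enum. Qed.

Lemma sub_vset X : X \subset vset (sspan X).
Proof. by apply/subsetP => x; rewrite inE; apply: mem_sspan. Qed.

Lemma sspan_sub X U : X \subset vset U -> (sspan X <= U)%VS.
Proof. by move=> /subsetP h; apply/span_subvP => x; rewrite mem_enum => /h; rewrite inE. Qed.

Lemma dim_sspan_leq X : \dim (sspan X) <= #|X|.
Proof. by rewrite cardE; apply: dim_span. Qed.

(** Scalars in ['F_2] are 0 and 1, so every element of the span is a sum of generators and closure
    under addition is enough. *)
Lemma sspan_ind (P : pred W) X :
  P 0%R -> (forall x y, P x -> P y -> P (x + y)%R) -> (forall x, x \in X -> P x) ->
  forall x, x \in sspan X -> P x.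
Proof.
move=> P0 PD PX x xs.
rewrite (coord_span (X := in_tuple (enum X)) xs); apply: (big_ind (fun y => is_true (P y))) => // i _.
case: (F2_cases (coord (in_tuple (enum X)) i x)) => ->; rewrite ?scale0r ?scale1r //.
by apply: PX; rewrite -mem_enum; exact: (mem_nth 0%R (ltn_ord i)).
Qed.

Definition periodic U E := forall u e, u \in U -> e \in E -> (u + e)%R \in E.

Lemma periodic_sspan X E :
  (forall x e, x \in X -> e \in E -> (x + e)%R \in E) -> periodic (sspan X) E.
Proof.
move=> h u e uX; suff : [forall e in E, (u + e)%R \in E] by move=> /forall_inP; apply.
move: u uX; apply: sspan_ind => [|x y /forall_inP hx /forall_inP hy|x xX];
  apply/forall_inP => f fE; first by rewrite add0r.
- by rewrite -addrA hx ?hy.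
- exact: h.
Qed.

Lemma vsetP U x : (x \in vset U) = (x \in U).
Proof. by rewrite inE. Qed.

(** A periodic set is a disjoint union of cosets of [U]; the induction removes the coset of one
    element at a time and collects representatives. *)
Lemma periodic_transversal U E :
  periodic U E -> exists R : {set W}, [/\ R \subset E, E = sumset R (vset U) & #|E| = #|R| * 2 ^ \dim U].
Proof.
have [m] := ubnP #|E|; elim: m E => // m IHm E Em perE.
have [->|[e eE]] := set_0Vmem E; first by exists set0; rewrite sumset0 sub0set cards0.
pose T := translate e (vset U).
have TE : T \subset E.
  apply/subsetP => x; rewrite mem_translate inE => exU.
  by rewrite -(addKv e x) addrCA addrC -addrA addrC; rewrite [(x + e)%R]addrC perE.
have cT : #|T| = 2 ^ \dim U by rewrite card_translate card_vset.
have [||R [RE eR cR]] := IHm (E :\: T).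
- have := cardsID T E; rewrite (setIidPr TE) cT; have := expn_gt0 2 (\dim U); lia.
- move=> u x uU; rewrite !inE !mem_translate !inE => /andP[xT xE]; rewrite perE // andbT.
  apply: contraNN xT => h; have -> : (e + x = u + (e + (u + x)))%R by vec2.
  exact: memvD.
have eT : e \in T by rewrite mem_translate addvv inE mem0v.
exists (e |: R); split.
- by rewrite subUset sub1set eE (subset_trans RE) // subsetDl.
- by rewrite sumsetU1 -eR -/T -{1}(setID E T) (setIidPr TE).
- have eNR : e \notin R by apply/negP => /(subsetP RE); rewrite inE eT.
  by rewrite cardsU1 eNR mulnDl mul1n -cR -cT -(cardsID T E) (setIidPr TE).
Qed.

Lemma dvdn_periodic U E : periodic U E -> 2 ^ \dim U %| #|E|.
Proof. by move=> /periodic_transversal[R [_ _ ->]]; apply: dvdn_mull. Qed.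

(* Dyson's transform replaces [(A, B)] by [(A :|: (s + B), B :&: (s + A))],
   keeping [|A| + |B|] and shrinking the sumset; at a pair with [|B|] minimal
   subject to [u <= |B|], every nontrivial transform would drop below [u]. *)
Lemma dyson_pair X u : 0 < u <= #|X| ->
  exists A B, [/\ sumset A B \subset sumset X X,
    (A \subset vset (sspan X)) && (B \subset vset (sspan X)),
    #|A| + #|B| = #|X| + #|X|, (u <= #|B|) && (#|B| <= #|X|) &
    forall s, reps A B s = #|B| \/ reps A B s < u].
Proof.
move=> /andP[u0 uX].
pose good (p : {set W} * {set W}) :=
  [&& sumset p.1 p.2 \subset sumset X X, p.1 \subset vset (sspan X),
      p.2 \subset vset (sspan X), #|p.1| + #|p.2| == #|X| + #|X| & u <= #|p.2|].
have gX : good (X, X) by rewrite /good /= subxx sub_vset eqxx uX.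
case: (arg_minnP (fun p : {set W} * {set W} => #|p.2|) gX) => -[A B] /= /and5P[/= sAB AX BX /eqP cAB uB] bmin.
exists A, B; split; rewrite ?AX ?BX ?uB ?(bmin _ gX) // => s.
have [|us] := ltnP (reps A B s) u; first by right.
left; pose A' := A :|: translate s B; pose B' := [set b in B | (s + b)%R \in A].
have B'B : B' \subset B by apply/subsetP => b; rewrite inE => /andP[].
have sX : s \in sspan X.
  have /sumsetP[a [b [aA bB ->]]] : s \in sumset A B by rewrite -reps_gt0 (leq_trans u0).
  by apply: memvD; rewrite -vsetP; [apply: (subsetP AX)|apply: (subsetP BX)].
have g' : good (A', B').
  apply/and5P; split=> //=.
  - apply: subset_trans sAB; apply/subsetP => _ /sumsetP[x [y [xA yB ->]]].
    move: yB; rewrite inE => /andP[yB syA].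
    case/setUP: xA => [xA|]; first exact: mem_sumset.
    rewrite mem_translate => sxB; have -> : (x + y = (s + y) + (s + x))%R by vec2.
    exact: mem_sumset.
  - rewrite subUset AX; apply/subsetP => x /imsetP[b bB ->].
    by rewrite inE memvD // -vsetP; apply: (subsetP BX).
  - exact: subset_trans BX.
  - rewrite -cAB; have -> : #|B'| = #|A :&: translate s B|.
      rewrite -(card_translate s B'); apply: eq_card => x.
      by rewrite !inE !mem_translate inE addKv andbC.
    by rewrite cardsUI card_translate.
apply/eqP; rewrite eqn_leq reps_leq /=; exact: (bmin _ g').
Qed.

(* Petridis: the subset of [A] with the smallest growth [|X + A| / |X|]. *)
Lemma petridis A : A != set0 ->
  exists X, [/\ X \subset A, X != set0, #|sumset X A| * #|A| <= #|sumset A A| * #|X| &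
    forall C, #|sumset (sumset X A) C| * #|X| <= #|sumset X A| * #|sumset X C|].
Proof.
move=> A0; pose F X : rat := (#|sumset X A|%:R / #|X|%:R)%R.
pose good X := (X \subset A) && (X != set0).
have gA : good A by rewrite /good subxx.
case: (Order.TotalTheory.arg_minP F gA) => X /andP[XA X0] Xmin.
have cross Z : Z \subset A -> #|sumset X A| * #|Z| <= #|sumset Z A| * #|X|.
  move=> ZA; have [->|Z0] := eqVneq Z set0; first by rewrite cards0 muln0.
  have := Xmin Z; rewrite /good ZA Z0 /F => /(_ isT).
  rewrite ler_pdivrMr ?ltr0n ?card_gt0 // mulrAC ler_pdivlMr ?ltr0n ?card_gt0 //.
  by rewrite -!natrM ler_nat.
exists X; split=> //; first exact: cross.
move=> C; have [m] := ubnP #|C|; elim: m C => // m IHm C Cm.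
have [->|[x xC]] := set_0Vmem C; first by rewrite ![sumset _ set0]sumsetC !sumset0 cards0 muln0.
pose D := C :\ x; have eC : C = x |: D by rewrite setD1K.
have {IHm} IH := IHm D; have cC := cardsD1 x C; rewrite xC -/D in cC.
have {IH} IH := IH (ltac:(lia)); clear cC Cm.
rewrite eC ![sumset _ (x |: D)]sumsetC !sumsetU1 ![sumset D _]sumsetC.
set S := sumset (sumset X A) D in IH *; set T := sumset X D in IH *.
(* [Z] marks the translates [x + z + A] already covered by [S]. Adding [x] to [D] gains at most
   [|X + A| - |Z + A|] elements on the left and at least [|X| - |Z|] on the right; minimality of the
   growth of [X], applied to [Z], compares the two. *)
pose Z := [set z in X | translate x (translate z A) \subset S].
have ZX : Z \subset X by apply/subsetP => z; rewrite inE => /andP[].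
have ZA := subset_trans ZX XA.
have up : #|translate x (sumset X A) :|: S| + #|sumset Z A| <= #|S| + #|sumset X A|.
  rewrite cardsU -(card_translate x (sumset X A)) addnC.
  have h : #|sumset Z A| <= #|translate x (sumset X A) :&: S|.
    rewrite -(card_translate x); apply/subset_leq_card/subsetP => s.
    rewrite mem_translate => /sumsetP[z [a [zZ aA e]]].
    have zX := subsetP ZX _ zZ.
    rewrite inE mem_translate e mem_sumset //=.
    move: zZ; rewrite inE => /andP[_ /subsetP]; apply.
    by rewrite !mem_translate e addKv.
  have := subset_leq_card (subsetIl (translate x (sumset X A)) S); lia.
have lo : #|T| + #|X| <= #|translate x X :|: T| + #|Z|.
  rewrite cardsU card_translate.
  have h : #|translate x X :&: T| <= #|Z|.
    rewrite -(card_translate x Z); apply/subset_leq_card/subsetP => s.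
    rewrite !inE !mem_translate inE => /andP[xs sT]; rewrite xs /=.
    apply/subsetP => v; rewrite !mem_translate => h.
    case/sumsetP: sT => y [d [yX dD es]]; rewrite es in h.
    apply/sumsetP; exists (y + (v + (y + d)))%R, d; split=> //; last by vec2.
    apply: mem_sumset => //.
    by have -> : (v + (y + d) = x + (y + d) + (x + v))%R by vec2.
  have := subset_leq_card (subsetIl (translate x X) T); rewrite card_translate; lia.
have crZ := cross Z ZA.
nia.
Qed.

(** Petridis' set [X] satisfies [|X + 3A| <= K ^ 3 |X|], so at most [K ^ 3] disjoint translates
    [z + X] fit with [z] in [X + X + A]. For a maximal such packing [Z], the set [X + X + A] lies in
    [Z + X + X]; hence [<Z> + X + X] is invariant under [A] and contains a coset of [<A>]. *)
Lemma ruzsa_span A K : A != set0 -> #|sumset A A| <= K * #|A| ->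
  2 ^ \dim (sspan A) <= K * 2 ^ (K ^ 3) * #|A|.
Proof.
move=> A0 hK; have [X [XA X0 XAK pet]] := petridis A0.
have cX : 0 < #|X| by rewrite card_gt0.
have cA : 0 < #|A| by rewrite card_gt0.
have K1 : #|sumset X A| <= K * #|X|.
  by rewrite -(leq_pmul2r cA) (leq_trans XAK) // mulnAC leq_mul2r hK orbT.
have K2 C : #|sumset (sumset X A) C| <= K * #|sumset X C|.
  rewrite -(leq_pmul2r cX) (leq_trans (pet C)) // mulnAC leq_mul2r K1 orbT //.
have K3 : #|sumset (sumset (sumset X A) A) A| <= K ^ 3 * #|X|.
  rewrite -[sumset _ A in X in X <= _]sumsetA (leq_trans (K2 _)) // sumsetA.
  rewrite (leq_trans (leq_mul (leqnn K) (K2 _))) // !expnS expn0 muln1 -!mulnA !leq_mul2l K1 !orbT //.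
pose T := sumset (sumset X X) A.
pose packing Z := (Z \subset T) && (#|sumset Z X| == #|Z| * #|X|).
have [Z /maxsetP[/andP[ZT /eqP Zpack] Zmax] _] : {Z | maxset packing Z & set0 \subset Z}.
  by apply: maxset_exists; rewrite /packing sub0set sumset0 !cards0.
have cZ : #|Z| <= K ^ 3.
  rewrite -(leq_pmul2r cX) -Zpack (leq_trans _ K3) // subset_leq_card //.
  apply/subsetP => _ /sumsetP[z [x3 [/(subsetP ZT) zT x3X ->]]].
  case/sumsetP: zT => y [a [/sumsetP[x1 [x2 [x1X x2X ->]]] aA ->]].
  by rewrite [(x1 + x2 + a)%R]addrAC !mem_sumset // (subsetP XA).
have cover t : t \in T -> t \in sumset Z (sumset X X).
  move=> tT; have [tZ|tZ] := boolP (t \in Z).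
    case/set0Pn: X0 => x xX; have -> : (t = t + (x + x))%R by vec2.
    by rewrite !mem_sumset.
  have : ~~ packing (t |: Z).
    by apply/negP => /Zmax e; move: tZ; rewrite -(e (subsetUr _ _)) setU11.
  rewrite /packing subUset sub1set tT ZT /= sumsetU1 cardsU1 tZ add1n mulSn.
  rewrite cardsU card_translate Zpack => /eqP neq.
  have : translate t X :&: sumset Z X != set0 by apply/negP => /eqP e; apply: neq; rewrite e cards0 subn0.
  case/set0Pn => s; rewrite inE mem_translate => /andP[tsX /sumsetP[z [x [zZ xX e]]]].
  have -> : (t = z + (x + (t + s)))%R by rewrite e; vec2.
  by rewrite !mem_sumset.
pose S := sumset (vset (sspan Z)) (sumset X X).
have perS : periodic (sspan A) S.
  apply: periodic_sspan => a s aA /sumsetP[u [b [uZ bX ->]]].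
  have /cover/sumsetP[z [c [zZ cX' e]]] : (b + a)%R \in T by rewrite mem_sumset.
  have -> : (a + (u + b) = (u + z) + c)%R.
    by rewrite -addrA -e; vec2.
  by apply: mem_sumset => //; rewrite inE; apply: memvD; [rewrite -vsetP | apply: mem_sspan].
have S0 : 0 < #|S|.
  case/set0Pn: X0 => x xX; apply/card_gt0P; exists (0 + (x + x))%R.
  by rewrite !mem_sumset // inE mem0v.
have := dvdn_leq S0 (dvdn_periodic perS) => /leq_trans; apply.
have cS : #|S| <= 2 ^ (K ^ 3) * (K * #|A|).
  apply: leq_trans (_ : #|vset (sspan Z)| * #|sumset X X| <= _).
    by rewrite -cardsX /S /sumset curry_imset2X leq_imset_card.
  rewrite card_vset leq_mul ?leq_pexp2l //; first exact: leq_trans (dim_sspan_leq _) cZ.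
  apply: leq_trans (subset_leq_card (sumsetS (subxx X) XA)) (leq_trans K1 _).
  by rewrite leq_mul2l subset_leq_card ?orbT.
by rewrite (leq_trans cS) // mulnA [_ * K]mulnC.
Qed.
End Subspaces.

(** * Paths in the cube *)

(** [E0] is the edge set of a bipartite graph with end points [f e] and [g e]. In a smallest dense
    set of edges, a vertex of degree at most [d1] (or [d2] on the other side) could be deleted
    without losing density. *)
Lemma min_degree_subgraph (T : finType) (T1 T2 : finType) (f : T -> T1) (g : T -> T2)
    (E0 : {set T}) (d1 d2 : nat) :
  d1 * #|f @: E0| + d2 * #|g @: E0| < #|E0| ->
  exists E : {set T}, [/\ E \subset E0, E != set0,
    forall e, e \in E -> d1 < #|[set e' in E | f e' == f e]| &
    forall e, e \in E -> d2 < #|[set e' in E | g e' == g e]|].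
Proof.
pose dense (E : {set T}) := (E \subset E0) && (d1 * #|f @: E| + d2 * #|g @: E| < #|E|).
move=> h0; have dE0 : dense E0 by rewrite /dense subxx.
case: (arg_minnP (fun E : {set T} => #|E|) dE0) => E /andP[EE0 dE] Emin.
have rm (T' : finType) (h : T -> T') (e : T) : e \in E ->
    let E' := E :\: [set e' in E | h e' == h e] in
    [/\ E' \subset E, #|E| = #|E'| + #|[set e' in E | h e' == h e]|,
      #|E'| < #|E| & #|h @: E'| < #|h @: E|].
  move=> eE E'; have sF : [set e' in E | h e' == h e] \subset E.
    by apply/subsetP => x; rewrite inE => /andP[].
  have cE : #|E| = #|E'| + #|[set e' in E | h e' == h e]|.
    by rewrite -(cardsID [set e' in E | h e' == h e]) (setIidPr sF) addnC.
  have E'E : E' \subset E by apply: subsetDl.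
  split=> //.
    by rewrite cE -[X in X < _]addn0 ltn_add2l; apply/card_gt0P; exists e; rewrite inE eE eqxx.
  apply: proper_card; apply/properP; split; first exact: imsetS.
  exists (h e); first exact: imset_f.
  by apply/imsetP => -[x]; rewrite !inE => /andP[+ xE] ex; rewrite xE ex eqxx.
have no (E' : {set T}) : E' \subset E -> #|E'| < #|E| ->
    #|E'| <= d1 * #|f @: E'| + d2 * #|g @: E'|.
  move=> E'E lt; rewrite leqNgt; apply/negP => h; have := Emin E'.
  by rewrite /dense (subset_trans E'E) // h leqNgt lt => /(_ isT).
exists E; split=> //.
- by apply: contraTneq dE => ->; rewrite cards0 ltn0.
- move=> e /(rm _ f)[E'E cE ltE ltf]; have := no _ E'E ltE.
  have := subset_leq_card (imsetS g E'E); nia.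
- move=> e /(rm _ g)[E'E cE ltE ltf]; have := no _ E'E ltE.
  have := subset_leq_card (imsetS f E'E); nia.
Qed.

Section Cube.
Variables (n q : nat).
Local Notation W := 'rV['F_2]_n.
Variable z : 'I_q -> W.
Implicit Types (S : {set 'I_q}) (E : {set W * 'I_q}).

Definition subsum S : W := (\sum_(i in S) z i)%R.

(** An edge [(x, i)] joins [x] to [x + z i]. Two steps return to the side of [x], so only subsets of
    even size occur. *)
Definition level E (x0 : W) (j : nat) : {set {set 'I_q}} :=
  [set S : {set 'I_q} | (#|S| == j.*2) && [exists i, (x0 + subsum S, i)%R \in E]].

Lemma subsumU1 i S : i \notin S -> subsum (i |: S) = (z i + subsum S)%R.
Proof. by move=> iS; rewrite /subsum big_setU1. Qed.

(* Counting the paths of length 2 from level [2 j] to level [2 j + 2] of the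
   cube, every one of which flips two coordinates upwards. *)
Lemma level_growth E (x0 : W) (d1 d2 j : nat) :
  (forall x i, (x, i) \in E -> d1 <= #|[set i' | (x, i') \in E]|) ->
  (forall x i, (x, i) \in E -> d2 <= #|[set i' | (x + z i + z i', i')%R \in E]|) ->
  #|level E x0 j| * ((d1 - j.*2) * (d2 - j.*2.+1)) <=
  #|level E x0 j.+1| * (j.+1.*2 * j.*2.+1).
Proof.
move=> h1 h2; set L := level E x0.
pose step S (p : 'I_q * 'I_q) := [&& p.1 \notin S, p.2 \notin S, p.2 != p.1,
  (x0 + subsum S, p.1)%R \in E & (x0 + subsum S + z p.1 + z p.2, p.2)%R \in E].
pose N := [set t : {set 'I_q} * ('I_q * 'I_q) | (t.1 \in L j) && step t.1 t.2].
have low : #|L j| * ((d1 - j.*2) * (d2 - j.*2.+1)) <= #|N|.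
  have -> : #|N| = \sum_(S in L j) #|[set p | step S p]|.
    rewrite -sum1_card (eq_bigl (fun t => (t.1 \in L j) && step t.1 t.2)); last by move=> t; rewrite inE.
    rewrite -(pair_big_dep (mem (L j)) step (fun _ _ => 1)) /=.
    by apply: eq_bigr => S _; rewrite -sum1_card; apply: eq_bigl => p; rewrite inE.
  rewrite -sum_nat_const; apply: leq_sum => S; rewrite inE => /andP[/eqP cS /existsP[i0 xE]].
  pose I1 := [set i | ((x0 + subsum S, i)%R \in E) && (i \notin S)].
  have cI1 : d1 - j.*2 <= #|I1|.
    have -> : I1 = [set i' | (x0 + subsum S, i')%R \in E] :\: S.
      by apply/setP => i; rewrite !inE andbC.
    apply: leq_trans (leq_sub2r _ (h1 _ _ xE)) _.
    by rewrite cardsD leq_sub2l // -cS subset_leq_card ?subsetIr.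
  have -> : #|[set p | step S p]| = \sum_(i in I1) #|[set i' | step S (i, i')]|.
    rewrite -sum1_card (eq_bigl (fun p => (p.1 \in I1) && step S (p.1, p.2))); last first.
      by case=> i i'; rewrite !inE /step /=; case: (_ \in E); case: (i \notin S); rewrite ?andbF.
    rewrite -(pair_big_dep (mem I1) (fun i i' => step S (i, i')) (fun _ _ => 1)) /=.
    by apply: eq_bigr => i _; rewrite -sum1_card; apply: eq_bigl => p; rewrite inE.
  apply: leq_trans (_ : #|I1| * (d2 - j.*2.+1) <= _); first by rewrite leq_mul2r cI1 orbT.
  rewrite -sum_nat_const; apply: leq_sum => i; rewrite inE => /andP[iE iS].
  have -> : [set i' | step S (i, i')] =
      [set i' | (x0 + subsum S + z i + z i', i')%R \in E] :\: (i |: S).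
    by apply/setP => i'; rewrite !inE /step /= iS iE /=; case: (i' \in S); case: (i' == i).
  apply: leq_trans (leq_sub2r _ (h2 _ _ iE)) _; rewrite cardsD leq_sub2l //.
  by apply: leq_trans (subset_leq_card (subsetIr _ _)) _; rewrite cardsU1 iS cS.
apply: leq_trans low _.
(* A set of size [2 j + 2] arises from at most [(2 j + 2) (2 j + 1)] ordered choices of the two
   coordinates added last. *)
pose M := [set t : {set 'I_q} * ('I_q * 'I_q) | (t.1 \in L j.+1) && ((t.2.1 \in t.1) && (t.2.2 \in t.1 :\ t.2.1))].
pose up (t : {set 'I_q} * ('I_q * 'I_q)) := (t.2.1 |: (t.2.2 |: t.1), t.2).
have up_inj : {in N &, injective up}.
  move=> [S [a b]] [S' [a' b']]; rewrite !inE /step /= => /andP[_ /and5P[aS bS ba _ _]] /andP[_ /and5P[aS' bS' ba' _ _]].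
  rewrite /up /= => -[eS ea eb]; subst a' b'; congr (_, _).
  have := congr1 (fun B => (B :\ a) :\ b) eS.
  by rewrite !setU1K // !inE negb_or eq_sym ba.
rewrite -(card_in_imset up_inj).
have -> : #|L j.+1| * (j.+1.*2 * j.*2.+1) = #|M|.
  rewrite -[RHS]sum1_card (eq_bigl (fun t : {set 'I_q} * ('I_q * 'I_q) =>
    (t.1 \in L j.+1) && ((t.2.1 \in t.1) && (t.2.2 \in t.1 :\ t.2.1)))); last by move=> t; rewrite inE.
  rewrite -(pair_big_dep (mem (L j.+1)) (fun S p => (p.1 \in S) && (p.2 \in S :\ p.1)) (fun _ _ => 1)) /=.
  rewrite -sum_nat_const; apply: eq_bigr => S; rewrite inE => /andP[/eqP cS _].
  rewrite -(pair_big_dep (mem S) (fun i i' => i' \in S :\ i) (fun _ _ => 1)) /=.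
  rewrite -cS -sum_nat_const; apply: eq_bigr => i iS.
  by rewrite sum1_card; have := cardsD1 i S; rewrite iS cS doubleS add1n => -[->].
apply/subset_leq_card/subsetP => _ /imsetP[[S [a b]] + ->].
rewrite !inE /step /up /= => /andP[/andP[/eqP cS _] /and5P[aS bS ba _ bE]].
have aS' : a \notin b |: S by rewrite !inE negb_or eq_sym ba.
rewrite eqxx ba eqxx orbT !andbT cardsU1 aS' cardsU1 bS cS /= doubleS eqxx /=.
apply/existsP; exists b; rewrite !subsumU1 //.
by have -> : (x0 + (z a + (z b + subsum S)) = x0 + subsum S + z a + z b)%R by vec2.
Qed.

(** Below level [J] the degrees far exceed the coordinates already used, so each level is at least
    [l] times as large as the previous one. *)
Lemma many_vertices E (x0 : W) (i0 : 'I_q) (d1 d2 J l : nat) :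
  (x0, i0) \in E -> J.*2.*2 <= d2 -> J.*2 * l.+1 <= d1 ->
  (forall x i, (x, i) \in E -> d1 <= #|[set i' | (x, i') \in E]|) ->
  (forall x i, (x, i) \in E -> d2 <= #|[set i' | (x + z i + z i', i')%R \in E]|) ->
  l ^ J <= #|[set S : {set 'I_q} | [exists i, (x0 + subsum S, i)%R \in E]]|.
Proof.
move=> x0E hd2 hd1 h1 h2.
pose L := level E x0.
have grow j : j <= J -> l ^ j <= #|L j|.
  elim: j => [_|j IHj jJ].
    rewrite expn0; apply/card_gt0P; exists set0; rewrite inE cards0 eqxx /=.
    by apply/existsP; exists i0; rewrite /subsum big_set0 addr0.
  have := level_growth x0 j h1 h2; rewrite -/L => h.
  rewrite -(@leq_pmul2r (j.+1.*2 * j.*2.+1)) ?muln_gt0 ?double_gt0 //.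
  apply: leq_trans h; rewrite expnSr -mulnA; apply: leq_mul; first exact/IHj/ltnW.
  (* The factors are compared as [l (2 j + 1) <= d1 - 2 j] and [2 j + 2 <= d2 - (2 j + 1)]. *)
  rewrite [j.+1.*2 * _]mulnC mulnA; apply: leq_mul; last by lia.
  nia.
apply: leq_trans (grow J (leqnn J)) _; apply/subset_leq_card/subsetP => S.
by rewrite !inE => /andP[].
Qed.
End Cube.

(** * Cheaply described sets *)

Section Cheap.
Variable n : nat.
Local Notation W := 'rV['F_2]_n.

Definition rows d m (C : 'M['F_2]_(m, d)) : {set 'rV['F_2]_d} := [set row i C | i : 'I_m].

Definition lincombs d m (C : 'M['F_2]_(m, d)) : {set 'rV['F_2]_d} :=
  [set (c *m C)%R | c : 'rV['F_2]_m].

Lemma rows_of_set d (Y : {set 'rV['F_2]_d}) y :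
  Y != set0 -> #|Y| <= y -> exists C : 'M_(y, d), rows C = Y.
Proof.
(* Rows beyond the size of [Y] repeat [y0], which is why [Y] must be nonempty. *)
case/set0Pn => y0 y0Y hY; exists (\matrix_(i < y) nth y0 (enum Y) i)%R.
apply/setP => x; apply/imsetP/idP => [[i _ ->]|xY].
  rewrite rowK; have [lt|ge] := ltnP i (size (enum Y)); last by rewrite nth_default.
  by rewrite -mem_enum mem_nth.
have lt : index x (enum Y) < y by rewrite (leq_trans _ hY) // cardE index_mem mem_enum.
by exists (Ordinal lt); rewrite // rowK /= nth_index // mem_enum.
Qed.

Lemma card_Fp2 : #|'F_2| = 2. Proof. exact: card_Fp. Qed.

Lemma coordinates (U : {vspace W}) :
  exists (D : 'M['F_2]_(\dim U, n)) (c : W -> 'rV['F_2]_(\dim U)),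
    [/\ forall x, x \in U -> (c x *m D)%R = x & forall x y, c (x + y)%R = (c x + c y)%R].
Proof.
exists (\matrix_(i < \dim U) (vbasis U)`_i)%R, (fun x => \row_i coord (vbasis U) i x)%R.
split=> [x xU|x y]; last by apply/rowP => i; rewrite !mxE linearD.
rewrite mulmx_sum_row [RHS](coord_vbasis xU); apply: eq_bigr => i _.
by rewrite rowK mxE.
Qed.

(* The three kinds of coordinate patterns: sums of two lists, arbitrary sets,
   and unions of cosets of a subspace with a list of points removed. *)
Definition pattern (t : 'I_3) (d y m : nat) : {set {set 'rV['F_2]_d}} :=
  if t == 0%R then
    [set sumset (rows p.1) (rows p.2) | p : 'M['F_2]_(y, d) * 'M['F_2]_(m, d)]
  else if t == 1%R then [set: {set 'rV['F_2]_d}]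
  else [set sumset (rows p.1) (lincombs p.2.1) :\: rows p.2.2 |
         p : 'M['F_2]_(y, d) * ('M['F_2]_(d, d) * 'M['F_2]_(m, d))].

Definition pattern_bits (t : 'I_3) (d y m : nat) : nat :=
  if t == 0%R then (y + m) * d else if t == 1%R then 2 ^ d else d ^ 2 + (y + m) * d.

Lemma card_pattern t d y m : #|pattern t d y m| <= 2 ^ pattern_bits t d y m.
Proof.
rewrite /pattern /pattern_bits; case: ifP => _; [|case: ifP => _].
- by rewrite (leq_trans (leq_imset_card _ _)) // card_prod !card_mx card_Fp2 -expnD mulnDl.
- by rewrite -powersetT card_powerset cardsT card_mx card_Fp2 mul1n.
- rewrite (leq_trans (leq_imset_card _ _)) // !card_prod !card_mx card_Fp2 -!expnD.
  by rewrite leq_pexp2l // mulnDl; lia.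
Qed.

(** In use, [D] lists a basis of a subspace and [Z] a set of translates, at [n] bits per row; the
    pattern [G] is described in only [d] coordinates. *)
Definition place d j (G : {set 'rV['F_2]_d}) (D : 'M['F_2]_(d, n)) (Z : 'M['F_2]_(j, n)) :
    {set W} := sumset [set (g *m D)%R | g in G] (rows Z).

Definition family t d j y m : {set {set W}} :=
  [set place p.1 p.2.1 p.2.2 | p in setX (pattern t d y m)
     [set: 'M['F_2]_(d, n) * 'M['F_2]_(j, n)]].

Lemma card_family t d j y m :
  #|family t d j y m| <= 2 ^ (pattern_bits t d y m + n * (d + j)).
Proof.
rewrite (leq_trans (leq_imset_card _ _)) // cardsX cardsT card_prod !card_mx card_Fp2 -expnD.
by rewrite [X in _ <= X]expnD leq_mul ?card_pattern // leq_pexp2l //; lia.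
Qed.

(* [n + 1] bits more elements than bits needed to describe it. *)
Definition cheap (N : nat) (F : {set W}) : Prop :=
  exists t d j y m, [/\ [&& d <= n, j <= n, y <= N & m <= N], F \in family t d j y m &
    pattern_bits t d y m + n * (d + j) + n.+1 <= #|F|].

Lemma dim_leq (U : {vspace W}) : \dim U <= n.
Proof. by have := dimvS (subvf U); rewrite dimvf /dim /= mul1n. Qed.

Lemma imset_coords d (D : 'M['F_2]_(d, n)) (c : W -> 'rV['F_2]_d) (Y : {set W}) :
  {in Y, forall x, (c x *m D)%R = x} -> [set (g *m D)%R | g in c @: Y] = Y.
Proof.
move=> h; rewrite -imset_comp -[RHS]imset_id.
by apply: eq_in_imset => x xY /=; rewrite h.
Qed.

Lemma sub_vset_in (U : {vspace W}) (Y : {set W}) x : Y \subset vset U -> x \in Y -> x \in U.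
Proof. by move=> /subsetP h /h; rewrite inE. Qed.

Lemma sumset_neq0 (A B : {set W}) : sumset A B != set0 -> A != set0 /\ B != set0.
Proof. by case/set0Pn => _ /sumsetP[a [b [aA bB _]]]; split; apply/set0Pn; [exists a|exists b]. Qed.

(** Once a basis of [U] is paid for, each point of [Y] and [B] costs [\dim U] bits instead of
    [n]. *)
Lemma cheap_sumset N (U : {vspace W}) (Y B Z : {set W}) y m j :
  Y \subset vset U -> B \subset vset U -> #|Y| <= y -> #|B| <= m -> #|Z| <= j ->
  [&& j <= n, y <= N & m <= N] ->
  n * (\dim U + j) + (y + m) * \dim U + n.+1 <= #|sumset (sumset Y B) Z| ->
  cheap N (sumset (sumset Y B) Z).
Proof.
move=> YU BU Yy Bm Zj bnd big.
have [YB0 Z0] : sumset Y B != set0 /\ Z != set0.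
  by apply: sumset_neq0; rewrite -card_gt0; apply: leq_trans big; rewrite addnS.
have [Y0 B0] := sumset_neq0 YB0.
have [D [c [cD cA]]] := coordinates U.
have [||C1 eC1] := @rows_of_set _ (c @: Y) y; [by rewrite imset_eq0 | exact: leq_trans (leq_imset_card _ _) Yy |].
have [||C2 eC2] := @rows_of_set _ (c @: B) m; [by rewrite imset_eq0 | exact: leq_trans (leq_imset_card _ _) Bm |].
have [CZ eCZ] := rows_of_set Z0 Zj.
exists 0%R, (\dim U), j, y, m; split; first by rewrite dim_leq.
- apply/imsetP; exists (sumset (rows C1) (rows C2), (D, CZ)).
    by rewrite !inE andbT; apply/imsetP; exists (C1, C2).
  rewrite /place /= eCZ eC1 eC2; congr sumset.
  transitivity [set (g *m D)%R | g in c @: sumset Y B].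
    rewrite imset_coords // => _ /sumsetP[a [b [aY bB ->]]]; apply: cD; apply: memvD.
      exact: sub_vset_in aY.
    exact: sub_vset_in bB.
  suff -> : c @: sumset Y B = sumset (c @: Y) (c @: B) by [].
  apply/setP => g; apply/imsetP/sumsetP.
    by move=> [_ /sumsetP[a [b [aY bB ->]]] ->]; exists (c a), (c b); rewrite cA !imset_f.
  move=> [_ [_ [/imsetP[a aY ->] /imsetP[b bB ->] ->]]].
  by exists (a + b)%R; rewrite ?cA ?mem_sumset.
- by apply: leq_trans big; rewrite /pattern_bits eqxx; lia.
Qed.

(** Here [R] is given by its indicator function on [U], which costs [2 ^ \dim U] bits whatever the
    size of [R]. *)
Lemma cheap_subset N (U : {vspace W}) (R Z : {set W}) j :
  R \subset vset U -> #|Z| <= j -> j <= n ->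
  n * (\dim U + j) + 2 ^ \dim U + n.+1 <= #|sumset R Z| ->
  cheap N (sumset R Z).
Proof.
move=> RU Zj jn big.
have [R0 Z0] : R != set0 /\ Z != set0.
  by apply: sumset_neq0; rewrite -card_gt0; apply: leq_trans big; rewrite addnS.
have [D [c [cD cA]]] := coordinates U; have [CZ eCZ] := rows_of_set Z0 Zj.
exists 1%R, (\dim U), j, 0, 0; split; first by rewrite dim_leq jn.
- apply/imsetP; exists (c @: R, (D, CZ)); first by rewrite !inE.
  rewrite /place /= eCZ imset_coords // => x xR; apply: cD; exact: sub_vset_in xR.
- by apply: leq_trans big; rewrite /pattern_bits /=; lia.
Qed.

Lemma cheap_cosets N (U H : {vspace W}) (R L : {set W}) y m :
  R \subset vset U -> (H <= U)%VS -> L \subset vset U -> L != set0 -> #|R| <= y -> #|L| <= m ->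
  [&& 0 < n, y <= N & m <= N] ->
  n * (\dim U + 1) + (\dim U) ^ 2 + (y + m) * \dim U + n.+1 <= #|sumset R (vset H) :\: L| ->
  cheap N (sumset R (vset H) :\: L).
Proof.
move=> RU HU LU L0 Ry Lm bnd big.
have [R0 _] : R != set0 /\ vset H != set0.
  apply: sumset_neq0; rewrite -card_gt0; apply: leq_trans (subset_leq_card (subsetDl _ L)).
  by apply: leq_trans big; rewrite addnS.
have [D [c [cD cA]]] := coordinates U.
have cD' (A : {set W}) : A \subset vset U -> {in A, forall x, (c x *m D)%R = x}.
  by move=> AU x xA; apply: cD; apply: sub_vset_in xA.
have [||C1 eC1] := @rows_of_set _ (c @: R) y; [by rewrite imset_eq0 | exact: leq_trans (leq_imset_card _ _) Ry |].
have [||C2 eC2] := @rows_of_set _ (c @: L) m; [by rewrite imset_eq0 | exact: leq_trans (leq_imset_card _ _) Lm |].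
(* A basis of [H] in the coordinates of [U], padded with zero rows to a square matrix. *)
pose Hm : 'M['F_2]_(\dim U) := (\matrix_(i < \dim U) c (nth 0 (vbasis H) i))%R.
have HmP : lincombs Hm = c @: vset H.
  have cZ a x : (c (a *: x) = a *: c x)%R.
    have c0 : c 0%R = 0%R by have := cA 0%R 0%R; rewrite addr0 => /eqP; rewrite -subr_eq0 opprD addNKr oppr_eq0 => /eqP.
    by case: (F2_cases a) => ->; rewrite ?scale0r ?scale1r.
  have c0 : c 0%R = 0%R by have := cZ 0%R 0%R; rewrite !scale0r.
  have csum (a : 'rV['F_2]_(\dim U)) : (a *m Hm = c (\sum_i a 0 i *: nth 0 (vbasis H) i))%R.
    rewrite (big_morph c cA c0) mulmx_sum_row; apply: eq_bigr => i _.
    by rewrite rowK cZ.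
  apply/setP => g; apply/imsetP/imsetP => [[a _ ->]|[x xH ->]].
    rewrite csum; eexists; last by [].
    rewrite inE; apply: memv_suml => i _; apply: memvZ.
    have [lt|ge] := ltnP i (size (vbasis H)); last by rewrite nth_default ?mem0v.
    by apply: vbasis_mem; apply: mem_nth.
  have dHU : \dim H <= \dim U := dimvS HU.
  exists (\row_(i < \dim U) if insub (nat_of_ord i) is Some k then coord (vbasis H) k x else 0)%R => //.
  rewrite csum; congr c; rewrite inE in xH; rewrite {1}(coord_vbasis xH).
  rewrite [RHS](bigID (fun i : 'I_(\dim U) => i < \dim H)) /= [X in (_ + X)%R]big1 => [|i ge]; last first.
    by rewrite mxE insubN // scale0r.
  rewrite addr0 (big_ord_narrow dHU) /=; apply: eq_bigr => i _.
  by rewrite mxE /= (valK i).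
exists 2%R, (\dim U), 1, y, m; split; first by rewrite dim_leq.
- apply/imsetP; exists (sumset (rows C1) (lincombs Hm) :\: rows C2, (D, 0%R)).
    by rewrite !inE andbT; apply/imsetP; exists (C1, (Hm, C2)).
  rewrite /place /=; have -> : rows (0%R : 'M['F_2]_(1, n)) = [set 0%R].
    apply/setP => x; rewrite inE; apply/imsetP/eqP => [[i _ ->]|->]; first by apply/rowP => k; rewrite !mxE.
    by exists ord0 => //; apply/rowP => k; rewrite !mxE.
  have HU' : vset H \subset vset U by apply/subsetP => x; rewrite !inE; apply/subvP.
  have RHU : sumset R (vset H) \subset vset U.
    by apply/subsetP => _ /sumsetP[a [b [aR bH ->]]]; rewrite inE memvD // -vsetP; [apply: (subsetP RU)|apply: (subsetP HU')].
  rewrite [RHS]sumsetC sumset1 HmP eC1 eC2.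
  have -> : sumset (c @: R) (c @: vset H) :\: c @: L = c @: (sumset R (vset H) :\: L).
    apply/setP => g; rewrite inE; apply/andP/imsetP.
      move=> [gL /sumsetP[_ [_ [/imsetP[a aR ->] /imsetP[b bH ->] e]]]].
      exists (a + b)%R; last by rewrite cA.
      rewrite inE mem_sumset // andbT; apply: contra gL => abL.
      by rewrite e -cA imset_f.
    move=> [x]; rewrite inE => /andP[xL xRH] ->; split; last first.
      by case/sumsetP: xRH => a [b [aR bH ->]]; rewrite cA mem_sumset ?imset_f.
    apply: contra xL => /imsetP[x' x'L e].
    by rewrite -(cD' _ RHU x xRH) e (cD' _ LU).
  rewrite imset_coords; last by apply: cD'; apply: subset_trans RHU; apply: subsetDl.
  by apply/setP => x; rewrite mem_translate add0r.
- by apply: leq_trans big; rewrite /pattern_bits /=; lia.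
Qed.

(* Each cheap set [F] misses a random set with probability [2 ^ (1 - #|F|)], up
   to the element [0]. *)
Lemma cheap_union_bound N (bad : pred {set W}) :
  (forall A, bad A -> exists2 F, cheap N F & [disjoint F :\ 0%R & A]) ->
  #|[set A | bad A]| * 2 ^ n <= 3 * n.+1 ^ 2 * N.+1 ^ 2 * 2 ^ 2 ^ n.
Proof.
move=> badP.
pose I : finType := ('I_3 * ('I_n.+1 * 'I_n.+1) * ('I_N.+1 * 'I_N.+1))%type.
pose fam (i : I) := family i.1.1 i.1.2.1 i.1.2.2 i.2.1 i.2.2.
pose bits (i : I) := pattern_bits i.1.1 i.1.2.1 i.2.1 i.2.2 + n * (i.1.2.1 + i.1.2.2).
pose miss (F : {set W}) := [set A : {set W} | [disjoint F :\ 0%R & A]].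
have cW : #|{: W}| = 2 ^ n by rewrite card_mx card_Fp2 mul1n.
(* The exemption of 0 costs at most a factor 2. *)
have card_miss F : #|miss F| * 2 ^ #|F| <= 2 ^ (2 ^ n).+1.
  have -> : miss F = powerset (~: (F :\ 0%R)).
    by apply/setP => A; rewrite !inE disjoint_sym disjoints_subset.
  rewrite card_powerset -expnD leq_pexp2l //.
  have := cardsC (F :\ 0%R); rewrite cW => <-.
  by rewrite (cardsD1 0%R F) addnC -addSn leq_add2r; case: (_ \in F).
have sub : [set A | bad A] \subset
    \bigcup_(i : I) \bigcup_(F in fam i | bits i + n.+1 <= #|F|) miss F.
  apply/subsetP => A; rewrite inE => /badP[F [t [d [j [y [m [/and4P[dn jn yN mN] Ff big]]]]]] dis].
  apply/bigcupP; exists (t, (Ordinal (dn : d < n.+1), Ordinal (jn : j < n.+1)),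
    (Ordinal (yN : y < N.+1), Ordinal (mN : m < N.+1))) => //.
  by apply/bigcupP; exists F; rewrite ?inE //= Ff /bits /=.
have card_I : #|{: I}| = 3 * n.+1 ^ 2 * N.+1 ^ 2 by rewrite !card_prod !card_ord -!mulnn.
rewrite -card_I -[X in _ <= X]sum_nat_const.
apply: leq_trans (_ : (\sum_(i : I) #|\bigcup_(F in fam i | bits i + n.+1 <= #|F|) miss F|) * 2 ^ n <= _).
  rewrite leq_mul2r; apply/orP; right; apply: leq_trans (subset_leq_card sub) _.
  elim/big_rec2: _ => [|i a B _ h]; first by rewrite cards0.
  by apply: leq_trans (leq_card_setU _ _) _; rewrite leq_add2l.
rewrite big_distrl /=; apply: leq_sum => i _.
rewrite -(@leq_pmul2r (2 ^ (bits i).+1)) ?expn_gt0 //.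
apply: leq_trans (_ : \sum_(F in fam i | bits i + n.+1 <= #|F|) #|miss F| * 2 ^ n * 2 ^ (bits i).+1 <= _).
  rewrite -!big_distrl /=; do 2!apply: leq_mul => //.
  elim/big_rec2: _ => [|F a B _ h]; first by rewrite cards0.
  by apply: leq_trans (leq_card_setU _ _) _; rewrite leq_add2l.
apply: leq_trans (_ : \sum_(F in fam i | bits i + n.+1 <= #|F|) 2 ^ (2 ^ n).+1 <= _).
  apply: leq_sum => F /andP[_ big]; apply: leq_trans (card_miss F).
  by rewrite -mulnA -expnD leq_mul2l leq_pexp2l ?orbT //; lia.
rewrite sum_nat_cond_const; apply: leq_trans (_ : 2 ^ bits i * 2 ^ (2 ^ n).+1 <= _); last by rewrite !expnS; lia.
rewrite leq_mul2r; apply/orP; right; apply: leq_trans (card_family _ _ _ _ _).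
by apply/subset_leq_card/subsetP => F; rewrite inE => /andP[].
Qed.
End Cheap.

(** * Sets whose sumset contains no cheap set *)

Section Structure.
Variable n : nat.
Local Notation W := 'rV['F_2]_n.
Implicit Types (X A B P R Z : {set W}) (V : {vspace W}).

Lemma sumset_set0v A : sumset A [set 0%R] = A.
Proof.
by rewrite sumsetC sumset1; apply/setP => x; rewrite mem_translate add0r.
Qed.

Lemma ex_subset_card (T : finType) (A : {set T}) m :
  m <= #|A| -> exists2 B : {set T}, B \subset A & #|B| = m.
Proof.
move=> h; exists [set x in take m (enum A)].
  by apply/subsetP => x; rewrite inE => /mem_take; rewrite mem_enum.
by rewrite cardsE (card_uniqP _) ?take_uniq ?enum_uniq // size_take -cardE; case: ltngtP h.
Qed.

(** For a maximal subset [Z] of [X] with distinct classes modulo [V], the set [X] lies in [V + <Z>],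
    so [Z] has at least [\dim <X> - \dim V] elements. *)
Lemma separated_subset X V j : j + \dim V <= \dim (sspan X) ->
  exists Z, [/\ Z \subset X, #|Z| = j &
    {in Z &, forall z z', (z + z')%R \in V -> z = z'}].
Proof.
move=> hj.
pose sep Z := (Z \subset X) && [forall z in Z, forall z' in Z, ((z + z')%R \in V) ==> (z == z')].
have [Z /maxsetP[/andP[ZX /forall_inP Zsep] Zmax] _] : {Z | maxset sep Z & set0 \subset Z}.
  by apply: maxset_exists; rewrite /sep sub0set; apply/forall_inP => z; rewrite inE.
have sepP : {in Z &, forall z z', (z + z')%R \in V -> z = z'}.
  by move=> z z' zZ z'Z h; move/forall_inP: (Zsep z zZ) => /(_ z' z'Z); rewrite h => /eqP.
have cover x : x \in X -> x \in (V + sspan Z)%VS.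
  move=> xX; have [xZ|xZ] := boolP (x \in Z).
    by rewrite -(add0r x); apply: memv_add; rewrite ?mem0v ?mem_sspan.
  have : ~~ sep (x |: Z).
    by apply/negP => /Zmax e; move: xZ; rewrite -(e (subsetUr _ _)) setU11.
  rewrite /sep subUset sub1set xX ZX /= => /forall_inPn[z zxZ /forall_inPn[z' zxZ']].
  rewrite negb_imply => /andP[zzV neq].
  have [y yZ xyV] : exists2 y, y \in Z & (x + y)%R \in V.
    case/setU1P: zxZ => [ez|zZ]; case/setU1P: zxZ' => [ez'|zZ'].
    - by rewrite ez ez' eqxx in neq.
    - by exists z' => //; rewrite -ez.
    - by exists z => //; rewrite addrC -ez'.
    - by move: neq; rewrite (sepP _ _ zZ zZ' zzV) eqxx.
  by rewrite -(addvK x y); apply: memv_add; rewrite ?mem_sspan.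
have dZ : \dim (sspan X) <= \dim V + #|Z|.
  have sub : (sspan X <= V + sspan Z)%VS.
    by apply: sspan_sub; apply/subsetP => x xX; rewrite inE cover.
  apply: leq_trans (dimvS sub) (leq_trans (dimv_add_leqif _ _) _).
  by rewrite leq_add2l dim_sspan_leq.
have [|Z' Z'Z cZ'] := @ex_subset_card _ Z j; first by lia.
exists Z'; split=> //; first exact: subset_trans ZX.
by move=> z z' /(subsetP Z'Z) zZ /(subsetP Z'Z); apply: sepP.
Qed.

Lemma card_sumset_separated V R Z : R \subset vset V ->
  {in Z &, forall z z', (z + z')%R \in V -> z = z'} ->
  #|sumset R Z| = #|R| * #|Z|.
Proof.
move=> RV sep; rewrite /sumset curry_imset2X card_in_imset ?cardsX //.
move=> [r z] [r' z']; rewrite !inE /= => /andP[rR zZ] /andP[rR' zZ'] e.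
have ez : z = z'.
  apply: sep => //; have -> : (z + z' = r + r')%R.
    by apply/eqP; rewrite -addv_eq0 addrACA addrC [(z + r)%R]addrC [(z' + r')%R]addrC e addvv.
  by apply: memvD; rewrite -vsetP; apply: (subsetP RV).
by move: e; rewrite ez => /addIr ->.
Qed.

Definition no_cheap N X := forall F : {set W}, F \subset sumset X X -> ~ cheap N F.

(** If the capped count reached [2 t f], the greedy choice would give [m] points [Y] with
    [|Y + B| >= f], a cheap set. So the count is smaller: this excludes the first alternative of
    [popular_sums] and leaves fewer than [2 f] sums with [t] representations, which form [P]. *)
Lemma popular_structure X N y m t a f : 0 < n -> X != set0 -> no_cheap N X ->
  f = n * (\dim (sspan X)).+1 + (m + y) * \dim (sspan X) + n.+1 ->
  0 < t -> 2 * t * f <= y * a -> #|X| <= m * t -> y <= N -> m <= N ->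
  exists B P, [/\ B \subset X, #|B| <= y, #|P| < 2 * f &
    forall x, x \in X :\: B -> #|[set x' in X | (x + x')%R \notin P]| < a].
Proof.
move=> n0 X0 nc ef t0 htf hm yN mN.
have [B [BX By alt]] := popular_sums X y t a.
have mass : \sum_s minn (reps X B s) t < 2 * t * f.
  rewrite ltnNge; apply/negP => big.
  have [|Y [YX Ym cY]] := @greedy_sumset n X B t m f X0.
    apply: leq_trans (_ : m * t * f <= _); first by rewrite leq_mul2r hm orbT.
    by rewrite -mulnA leq_mul2l; apply/orP; right; lia.
  apply: (nc (sumset (sumset Y B) [set 0%R])); first by rewrite sumset_set0v sumsetS.
  apply: (@cheap_sumset _ _ (sspan X) _ _ _ m y 1); rewrite ?cards1 ?yN ?mN ?andbT //.
  - exact: subset_trans YX (sub_vset _).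
  - exact: subset_trans BX (sub_vset _).
  - by rewrite sumset_set0v (leq_trans _ cY) // ef addn1.
case: alt => [cov|sparse]; first by lia.
exists B, [set s | t <= reps X B s]; split=> //.
  rewrite -(ltn_pmul2l t0) mulnA [t * 2]mulnC; apply: leq_ltn_trans mass.
  rewrite mulnC -sum_nat_const [X in _ <= X](bigID [in [set s | t <= reps X B s]]) /=.
  apply: leq_trans (leq_addr _ _); apply: leq_sum => s; rewrite inE => ts.
  by rewrite leq_min ts /=.
move=> x xX; have := sparse x xX; congr (_ < _); apply: eq_card => x'.
by rewrite !inE ltnNge.
Qed.

(** Adding [10 n] points of [X] in [V] to [j] points separated modulo [V] gives [10 n j] distinct
    sums; the [j] points cost [n] bits each, but those in [V] only [d] bits each, which is cheap
    when [3 d <= j]. *)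
Lemma dense_subspace X N V d j : 0 < n -> no_cheap N X ->
  \dim V = d -> d + j = \dim (sspan X) -> 3 * d <= j -> 0 < j -> 10 * n <= N ->
  #|X :&: vset V| < 10 * n.
Proof.
move=> n0 nc dV hdj h3 j0 hN; rewrite ltnNge; apply/negP => big.
have [R RX cR] := ex_subset_card big.
have [|Z [ZX cZ sepZ]] := @separated_subset X V j; first by rewrite dV; lia.
have RV : R \subset vset V := subset_trans RX (subsetIr _ _).
have cF := card_sumset_separated RV sepZ.
apply: (nc (sumset (sumset R [set 0%R]) Z)).
  by rewrite sumset_set0v sumsetS // (subset_trans RX) ?subsetIl.
have dn := dim_leq (sspan X).
apply: (@cheap_sumset _ _ V _ _ _ (10 * n) 1 j); rewrite ?cards1 ?cR ?cZ ?hN //.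
- by rewrite sub1set inE mem0v.
- by apply/andP; split; lia.
- by rewrite sumset_set0v cF cR cZ dV; nia.
Qed.

(** The same sums [R + Z] as in [dense_subspace], with [R] now given by its indicator function. *)
Lemma small_span X N V R d j : 0 < n -> no_cheap N X ->
  \dim V = d -> R \subset X :&: vset V -> j + d <= \dim (sspan X) ->
  #|R| * j < n * (d + j) + 2 ^ d + n.+1.
Proof.
move=> n0 nc dV RX hj; rewrite ltnNge; apply/negP => big.
have [|Z [ZX cZ sepZ]] := @separated_subset X V j; first by rewrite dV; lia.
have RV : R \subset vset V := subset_trans RX (subsetIr _ _).
have cF := card_sumset_separated RV sepZ.
apply: (nc (sumset R Z)); first by rewrite sumsetS // (subset_trans RX) ?subsetIl.
have dn := dim_leq (sspan X).
by apply: (@cheap_subset _ _ V _ _ j); rewrite ?cZ ?cF ?dV ?cR //; lia.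
Qed.

Lemma free_points X q : q <= \dim (sspan X) ->
  exists s : q.-tuple W, free s /\ all [in X] s.
Proof.
elim: q => [|q IHq] hq; first by exists [tuple]; rewrite nil_free.
have [s [fs sX]] := IHq (ltnW hq).
have [/subsetP XS|/subsetPn[x xX]] := boolP (X \subset vset <<s>>%VS).
  have := dimvS (sspan_sub (introT subsetP XS)); have := eqP fs; rewrite size_tuple => ->.
  by rewrite leqNgt hq.
rewrite inE => xs; exists [tuple of x :: s].
by rewrite /= free_cons xs fs xX sX.
Qed.

Lemma subsum_inj q (s : q.-tuple W) : free s ->
  injective (subsum (fun i : 'I_q => s`_i)%R).
Proof.
move=> /freeP fr S S' e; pose k i : 'F_2 := ((i \in S)%:R + (i \in S')%:R)%R.
have sumE (T : {set 'I_q}) : subsum (fun i : 'I_q => s`_i)%R T = (\sum_i (i \in T)%:R *: s`_i)%R.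
  rewrite /subsum big_mkcond; apply: eq_bigr => i _.
  by case: (i \in T); rewrite ?scale1r ?scale0r.
have /fr k0 : (\sum_i k i *: s`_i = 0)%R.
  under eq_bigr do rewrite scalerDl.
  by rewrite big_split /= -!sumE e addvv.
apply/setP => i; have := k0 i; rewrite /k.
by case: (i \in S); case: (i \in S').
Qed.

(** Take [q] independent typical points [z i] and join [x] to [x + z i] whenever this lies in [P]:
    nearly all [q |X|] edges are present. A subgraph of large minimum degree then yields [l ^ J]
    points of [X] in the span of some [x0] and the [z i], of dimension at most [q + 1]. *)
Lemma path_contradiction X B P a q d1 d2 J l p :
  (forall V, \dim V <= q.+1 -> #|X :&: vset V| < 10 * n) ->
  (forall x, x \in X :\: B -> #|[set x' in X | (x + x')%R \notin P]| < a) ->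
  q <= \dim (sspan (X :\: B)) -> #|P| <= p ->
  d1 * #|X| + d2 * p + q * a < q * #|X| ->
  J.*2.*2 <= d2 -> J.*2 * l.+1 <= d1 -> l ^ J < 10 * n.
Proof.
move=> hV hP hq cP hd hd2 hd1.
have [s [fs /all_tnthP sX]] := free_points hq.
pose z (i : 'I_q) : W := (s`_i)%R.
have zX i : z i \in X :\: B by have := sX i; rewrite (tnth_nth 0%R).
pose E0 := [set e : W * 'I_q | (e.1 \in X) && ((e.1 + z e.2)%R \in P)].
have cE0 : q * #|X| <= #|E0| + q * a.
  have -> : #|E0| = \sum_(i < q) #|[set x in X | (x + z i)%R \in P]|.
    rewrite -sum1_card (eq_bigl (fun e => true && ((e.1 \in X) && ((e.1 + z e.2)%R \in P)))); last by move=> e; rewrite inE.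
    rewrite -(pair_big_dep xpredT (fun x i => (x \in X) && ((x + z i)%R \in P)) (fun _ _ => 1)) /=.
    rewrite (exchange_big_dep xpredT) //=; apply: eq_bigr => i _.
    by rewrite sum1dep_card; apply: eq_card => x; rewrite !inE.
  rewrite -[X in X * #|_|]card_ord -[X in _ + X * a]card_ord -!sum_nat_const -big_split /=.
  apply: leq_sum => i _; have lt := ltnW (hP _ (zX i)); apply: leq_trans (leq_add (leqnn _) lt).
  rewrite -(cardsID [set x | (x + z i)%R \in P] X) leq_add // subset_leq_card //.
    by apply/subsetP => x; rewrite !inE.
  by apply/subsetP => x; rewrite !inE addrC andbC.
have [|E [EE0 Ene h1 h2]] := @min_degree_subgraph _ _ _ fst (fun e => (e.1 + z e.2)%R) E0 d1 d2.
  have l1 : #|[set e.1 | e in E0]| <= #|X|.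
    by apply/subset_leq_card/subsetP => _ /imsetP[e + ->]; rewrite inE => /andP[].
  have l2 : #|[set (e.1 + z e.2)%R | e in E0]| <= p.
    apply: leq_trans cP; apply/subset_leq_card/subsetP => _ /imsetP[e + ->].
    by rewrite inE => /andP[].
  rewrite -(ltn_add2r (q * a)); apply: leq_trans cE0; apply: leq_ltn_trans hd.
  by rewrite leq_add2r leq_add // leq_mul2l ?l1 ?l2 orbT.
case/set0Pn: Ene => -[x0 i0] e0E.
apply: leq_ltn_trans (hV <<x0 :: s>>%VS _); last first.
  by apply: leq_trans (dim_span _) _; rewrite /= size_tuple.
apply: leq_trans (many_vertices (z := z) e0E hd2 hd1 _ _) _.
- move=> x i xE; apply: leq_trans (ltnW (h1 _ xE)) _.
  rewrite -(card_imset [set i' | (x, i') \in E] (f := pair x)); last by move=> ? ? [].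
  apply/subset_leq_card/subsetP => -[y j]; rewrite inE /= => /andP[yE /eqP ey]; subst y.
  by apply/imsetP; exists j; rewrite ?inE.
- move=> x i xE; apply: leq_trans (ltnW (h2 _ xE)) _.
  pose h (i' : 'I_q) := ((x + z i + z i')%R, i').
  rewrite -(card_imset [set i' | (x + z i + z i', i')%R \in E] (f := h)); last by move=> ? ? [].
  apply/subset_leq_card/subsetP => -[y j]; rewrite inE /= => /andP[yE /eqP ey].
  have ey' : y = (x + z i + z j)%R by rewrite -ey addvK.
  by apply/imsetP; exists j; rewrite ?inE /h -ey'.
rewrite -(card_imset _ (f := fun S => (x0 + subsum z S)%R)); last first.
  by move=> S S' /addrI /(subsum_inj fs).
apply/subset_leq_card/subsetP => _ /imsetP[S + ->]; rewrite inE => /existsP[i xE].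
have := subsetP EE0 _ xE; rewrite !inE /= => /andP[-> _] /=.
apply: memvD; first by rewrite memv_span ?mem_head.
apply: memv_suml => j _.
by apply: memv_span; rewrite inE mem_nth ?orbT // size_tuple.
Qed.

(** For typical [x1] and [x2], each [x] in [X] outside two small sets writes [x1 + x2] as
    [(x1 + x) + (x2 + x)] with both terms in [P]. Hence the typical part has doubling at most [K]
    and a small span by [ruzsa_span]; [small_span] then limits what the other points add to the
    rank. *)
Lemma rank_bound X N B P a j K : 0 < n -> no_cheap N X ->
  (forall x, x \in X :\: B -> #|[set x' in X | (x + x')%R \notin P]| < a) ->
  X :\: B != set0 -> 2 * a < #|X| -> #|P| ^ 2 <= K * (#|X| - 2 * a) * #|X :\: B| ->
  (forall d, 2 ^ d <= K * 2 ^ (K ^ 3) * #|X| -> n * (d + j) + 2 ^ d + n.+1 <= #|X :\: B| * j) ->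
  2 ^ \dim (sspan X) <= K * 2 ^ (K ^ 3) * #|X| * 2 ^ j.
Proof.
move=> n0 nc hP X'0 ha cP hj; set X' := X :\: B in X'0 cP hP hj *.
have XX : #|sumset X' X'| * (#|X| - 2 * a) <= #|P| ^ 2.
  rewrite -mulnn -sum_reps -sum_nat_const [X in _ <= X](bigID [in sumset X' X']) /=.
  apply: leq_trans (leq_addr _ _); apply: leq_sum => _ /sumsetP[x1 [x2 [x1X x2X ->]]].
  pose bad x := [set x' in X | (x + x')%R \notin P].
  apply: leq_trans (_ : #|translate x2 (X :\: (bad x1 :|: bad x2))| <= _).
    rewrite card_translate cardsD leq_sub2l // (leq_trans (subset_leq_card (subsetIr _ _))) //.
    apply: leq_trans (leq_card_setU _ _) _; rewrite mul2n -addnn.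
    by rewrite leq_add // ltnW ?hP.
  apply/subset_leq_card/subsetP => s; rewrite mem_translate !inE.
  move=> /andP[+ xX]; rewrite xX /= negb_or !negbK => /andP[p1 p2].
  rewrite addKv in p2; rewrite p2 /=.
  by have -> : (x1 + x2 + s = x1 + (x2 + s))%R by rewrite addrA.
have KX : #|sumset X' X'| <= K * #|X'|.
  rewrite -(@leq_pmul2r (#|X| - 2 * a)) ?subn_gt0 // (leq_trans XX) // (leq_trans cP) //.
  by rewrite mulnAC.
have := ruzsa_span X'0 KX => hd.
have hd' : 2 ^ \dim (sspan X') <= K * 2 ^ (K ^ 3) * #|X|.
  by apply: leq_trans hd _; rewrite leq_mul2l subset_leq_card ?orbT // subsetDl.
have [small|large] := leqP (\dim (sspan X)) (\dim (sspan X') + j).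
  apply: leq_trans (_ : 2 ^ (\dim (sspan X') + j) <= _); first by rewrite leq_pexp2l.
  by rewrite expnD leq_mul2r hd' orbT.
have := @small_span X N (sspan X') X' _ j n0 nc erefl.
rewrite subsetI subsetDl sub_vset addnC ltnW // => /(_ isT isT).
by rewrite ltnNge hj.
Qed.
End Structure.

(** * Small rank *)

Section Doubling.
Variable n : nat.
Local Notation W := 'rV['F_2]_n.
Implicit Types (X A B P R Z E : {set W}) (V : {vspace W}).

Lemma periodic_sub U E (F : {set W}) : periodic U E -> periodic U F -> periodic U (E :\: F).
Proof.
move=> pE pF u e uU; rewrite !inE => /andP[eF eE]; rewrite pE // andbT.
by apply: contra eF => /(pF u) -/(_ uU); rewrite addKv.
Qed.

Lemma periodic_translate U x E : periodic U E -> periodic U (translate x E).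
Proof.
by move=> pE u e uU; rewrite !mem_translate => h; rewrite addrCA pE.
Qed.

(* At a pair produced by Dyson's transform with [B] large, the set [E] of sums
   represented in the maximal number [#|B|] of ways is almost all of [A + B]
   by multiplicity; it is invariant under the popular differences of [B], and
   hence under all of [B + B]. *)
Lemma stuck_pair (S : {set W}) A B u xi bm :
  A \subset S -> B \subset S -> {in S &, forall x y, (x + y)%R \in S} ->
  (forall s, reps A B s = #|B| \/ reps A B s < u) ->
  u * #|S| <= xi * bm -> bm < #|B| -> 2 * xi <= bm ->
  exists E, [/\ periodic (sspan (sumset B B)) E,
    (forall b e, b \in B -> e \in E -> (e + b)%R \in A) & #|A| <= #|E| + xi].
Proof.
move=> AS BS Sadd dich hxi hb h2.
have b0 : 0 < #|B| by apply: leq_trans hb.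
pose E : {set W} := [set s | reps A B s == #|B|].
have EP e : e \in E -> forall b, b \in B -> (e + b)%R \in A.
  rewrite inE => /eqP h b bB; have : [set b in B | (e + b)%R \in A] == B.
    by rewrite eqEcard -[#|[set b in B | _]|]/(reps A B e) h leqnn andbT; apply/subsetP => x; rewrite inE => /andP[].
  by move=> /eqP/setP/(_ b); rewrite inE bB.
have sumS A' s : A' \subset S -> s \in sumset A' B -> s \in S.
  by move=> /subsetP A'S /sumsetP[a [b [aA bB ->]]]; apply: Sadd; [apply: A'S | apply: (subsetP BS)].
have few A' (D : {set W}) : A' \subset S -> (forall s, s \notin D -> reps A' B s <= u) ->
    #|A'| * #|B| <= #|D| * #|B| + xi * #|B|.
  move=> A'S hD; rewrite -sum_reps (bigID [in D]) /= leq_add //.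
    by rewrite -sum_nat_const leq_sum // => s _; apply: reps_leq.
  apply: leq_trans (_ : u * #|S| <= _); last by rewrite (leq_trans hxi) // leq_mul2l ltnW ?orbT.
  rewrite mulnC -sum_nat_const big_mkcond [X in _ <= X]big_mkcond leq_sum // => s _.
  case: ifP => // sD; case: ifP => [_|/negbT sS]; first exact: hD.
  by rewrite leqNgt reps_gt0; apply: contra sS; apply: sumS.
have cAE : #|A| <= #|E| + xi.
  rewrite -(leq_pmul2r b0) mulnDl; apply: few => // s.
  by rewrite inE; case: (dich s) => [->|/ltnW //]; rewrite eqxx.
pose D : {set W} := [set h | u <= reps B B h].
have cBD : #|B| <= #|D| + xi.
  rewrite -(leq_pmul2r b0) mulnDl; apply: few => // s.
  by rewrite inE -ltnNge => /ltnW.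
(* If [h] has [u] representations in [B + B], then [h + e] has at least [u] in [A + B], and the
   dichotomy puts it in [E]. *)
have ED : periodic (sspan D) E.
  apply: periodic_sspan => h e; rewrite inE => uh eE.
  have [hh|] := dich (h + e)%R; first by rewrite inE hh.
  rewrite ltnNge => /negP[]; apply: leq_trans uh _.
  apply/subset_leq_card/subsetP => b; rewrite !inE => /andP[-> hbB] /=.
  by have -> : (h + e + b = e + (h + b))%R by [vec2]; apply: EP.
(* A nonempty such [F] has at least [|D|] elements, so [|B| <= |D| + xi <= 2 xi], against
   [2 xi <= bm < |B|]. *)
have dvd_small (F : {set W}) : periodic (sspan D) F -> #|F| <= xi -> F = set0.
  move=> /dvdn_periodic dv small; apply/eqP; rewrite -cards_eq0 -leqn0 leqNgt; apply/negP => F0.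
  have := dvdn_leq F0 dv; rewrite -card_vset => le.
  have DF := leq_trans (subset_leq_card (sub_vset D)) le.
  have := leq_trans cBD (leq_add (leq_trans DF small) (leqnn xi)); lia.
have EBB : forall x e, x \in sumset B B -> e \in E -> (x + e)%R \in E.
  move=> x e /sumsetP[b1 [b2 [b1B b2B ->]]] eE; set h := (b1 + b2)%R.
  (* Both [E] and [h + E], translated by [b1], lie in [A], so they differ by at most
     [|A| - |E| <= xi] elements. *)
  have : translate h E :\: E = set0.
    apply: dvd_small; first by apply: periodic_sub => //; apply: periodic_translate.
    have sub : translate b1 (translate h E :|: E) \subset A.
      apply/subsetP => s; rewrite mem_translate inE mem_translate => /orP[] hs.
        by have -> : (s = (h + (b1 + s)) + b2)%R by [rewrite /h; vec2]; apply: EP.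
      by rewrite -(addKv b1 s) addrC; apply: EP.
    have := subset_leq_card sub; rewrite card_translate cardsU.
    have := cardsID E (translate h E).
    have := subset_leq_card (subsetIl (translate h E) E); rewrite card_translate; lia.
  by move/setP/(_ (h + e)%R); rewrite in_set0 in_setD mem_translate addKv eE andbT => /negbFE.
exists E; split=> //; first exact: periodic_sspan.
by move=> b e bB eE; apply: EP.
Qed.

(** Dyson's pair has two cases. If [|B| <= bm], a sample [Y] of [m] points of [A] gives a cheap
    [Y + B]. Otherwise [stuck_pair] provides a union [E] of cosets of [H = <B + B>] containing
    almost as many points as [A], and either [E] or [E] with one further translate of [B] is
    cheap. *)
Lemma doubling_contradiction X N k u bm w m p xi :
  0 < n -> no_cheap N X -> #|X| = (2 ^ k).+1 ->
  0 < u <= #|X| -> 4 * #|X| ^ 2 <= m * u * w -> 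
  n * (\dim (sspan X)).+1 + (m + bm) * \dim (sspan X) + n.+1 + w + bm <= 2 * #|X| ->
  u * 2 ^ \dim (sspan X) <= xi * bm -> 2 * xi <= bm -> 0 < bm -> 2 ^ \dim (sspan X) <= p * bm ->
  n * (\dim (sspan X)).+1 + \dim (sspan X) ^ 2 + (p.+1 + xi.+1) * \dim (sspan X) + n.+1 + xi.+2 <= 2 * 2 ^ k ->
  m <= N -> bm <= N -> p < N -> xi < N -> False.
Proof.
move=> n0 nc cX; set r := \dim (sspan X) => hu hm cost1 hxi h2xi bm0 hp cost2 mN bmN pN xiN.
have [A [B [sAB /andP[AU BU] cAB /andP[uB BX] dich]]] := dyson_pair hu.
have u0 : 0 < u by case/andP: hu.
have b0 : 0 < #|B| by apply: leq_trans uB.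
have A0 : A != set0 by rewrite -card_gt0; lia.
have SS : {in vset (sspan X) &, forall x y, (x + y)%R \in vset (sspan X)}.
  by move=> x y; rewrite !inE; apply: memvD.
have [small|large] := leqP #|B| bm.
  (* With cap [|B|] nothing is truncated, so covering all but [w] elements of [A] in number takes
     about [|A| ^ 2 / (|B| w)] translates. *)
  have Phi : \sum_s minn (reps A B s) #|B| = #|A| * #|B|.
    by rewrite -sum_reps; apply: eq_bigr => s _; apply/minn_idPl/reps_leq.
  have [|Y [YA Ym cY]] := @greedy_sumset n A B #|B| m (#|A| - w) A0.
    rewrite Phi [#|A| * #|B|]mulnC -mulnBr.
    have [wA|Aw] := leqP w #|A|; last by have -> : #|A| - w = 0 by [lia]; rewrite muln0.
    rewrite subKn //; apply: leq_trans (_ : 4 * #|X| ^ 2 <= _); first by nia.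
    by apply: leq_trans hm _; rewrite -mulnA leq_mul2l leq_mul2r uB !orbT.
  apply: (nc (sumset (sumset Y B) [set 0%R])).
    by rewrite sumset_set0v; apply: subset_trans (sumsetS YA (subxx B)) sAB.
  apply: (@cheap_sumset _ _ (sspan X) _ _ _ m bm 1); rewrite ?cards1 ?n0 ?mN ?bmN //.
    exact: subset_trans YA AU.
  by rewrite sumset_set0v (leq_trans _ cY) //; rewrite -/r; lia.
have [|E [perE EB cE]] := stuck_pair AU BU SS dich _ large h2xi; first by rewrite card_vset.
set H := sspan (sumset B B) in perE.
have BH b b' : b \in B -> b' \in B -> (b + b')%R \in H.
  by move=> bB b'B; rewrite mem_sspan ?mem_sumset.
have [b1 b1B] : exists b1, b1 \in B by apply/card_gt0P.
have EU : E \subset vset (sspan X).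
  apply/subsetP => e eE; rewrite -(addvK e b1); apply: SS; last exact: (subsetP BU).
  by apply: (subsetP AU); apply: EB.
have Bcos : B \subset translate b1 (vset H).
  by apply/subsetP => b bB; rewrite mem_translate inE BH.
have cH : #|B| <= 2 ^ \dim H by rewrite -card_vset -(card_translate b1 (vset H)) subset_leq_card.
have [R [RE eR cR]] := periodic_transversal perE.
have cEU : #|E| <= 2 ^ r by rewrite -card_vset subset_leq_card.
have HU : (H <= sspan X)%VS.
  apply: sspan_sub; apply/subsetP => _ /sumsetP[b [b' [bB b'B ->]]].
  by apply: SS; apply: (subsetP BU).
have cRp : #|R| <= p.
  rewrite -(leq_pmul2r bm0); apply: leq_trans hp; apply: leq_trans cEU; rewrite cR leq_mul2l.
  by apply/orP; right; exact: ltnW (leq_trans large cH).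
have EAB e : e \in E -> e \in sumset A B.
  by move=> eE; rewrite -(addvK e b1) mem_sumset // EB.
have [E2|E2] := leqP (2 * 2 ^ k) #|E|.
  apply: (nc (sumset R (vset H) :\: [set 0%R])).
    by apply: subset_trans (subsetDl _ _) _; rewrite -eR; apply: subset_trans sAB; apply/subsetP.
  apply: (@cheap_cosets _ N (sspan X) H _ _ p.+1 xi.+1); rewrite ?cards1 ?n0 ?pN ?xiN //.
  - exact: subset_trans RE EU.
  - by rewrite sub1set inE mem0v.
  - by apply/set0Pn; exists 0%R; rewrite inE.
  - by apply: leqW.
  - rewrite -eR -/r addn1 -(leq_add2r xi.+2) (leq_trans cost2) // (leq_trans E2) //.
    by rewrite (cardsD1 0%R E) addnC leq_add2l (leq_trans (leq_b1 _)).
have E0 : 0 < #|E|.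
  by rewrite lt0n; apply/eqP => E00; move: cE cAB BX large h2xi; rewrite E00; clear; lia.
have dvE : 2 ^ \dim H %| #|E| := dvdn_periodic perE.
have Hk : \dim H <= k.
  by rewrite -ltnS -(ltn_exp2l _ _ (ltnSn 1)) expnS (leq_ltn_trans (dvdn_leq E0 dvE)).
(* Both sizes are multiples of [2 ^ \dim H], so the strict inequality leaves room for a whole
   coset. *)
have EH : #|E| + 2 ^ \dim H <= 2 * 2 ^ k.
  have dv2 : 2 ^ \dim H %| 2 * 2 ^ k by rewrite dvdn_mull // dvdn_exp2l.
  case/dvdnP: dvE => e1 e1E; case/dvdnP: dv2 => e2 e2E; move: E2; rewrite e1E e2E.
  by rewrite ltn_pmul2r ?expn_gt0 // -mulSnr => lt; rewrite leq_mul2r lt orbT.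
(* Otherwise [|A| + |B| <= |E| + 2 ^ \dim H <= 2 ^ k.+1], but [|A| + |B| = 2 |X| = 2 ^ k.+1 + 2]:
   the one point beyond [2 ^ k] is used here. *)
have [a aA aE] : exists2 a, a \in A & a \notin translate b1 E.
  apply/subsetPn; apply/negP => /subset_leq_card; rewrite card_translate => AE.
  by move: AE cAB cH EH cX; clear; lia.
pose cos := translate (a + b1)%R (vset H).
pose F0 := translate a B.
have F0cos : F0 \subset cos.
  apply/subsetP => s; rewrite !mem_translate inE => sB.
  by have -> : (a + b1 + s = b1 + (a + s))%R by [vec2]; apply: BH.
have F0E : [disjoint E & F0].
  apply/pred0P => s /=; apply/negP => /andP[sE]; rewrite mem_translate => asB.
  move/negP: aE; apply; rewrite mem_translate.
  have -> : (b1 + a = (b1 + (a + s)) + s)%R by vec2.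
  by apply: perE => //; apply: BH.
have cosE : sumset (a + b1 |: R)%R (vset H) = cos :|: E by rewrite sumsetU1 -eR.
(* The coset [cos] exceeds [a + B] by at most [xi] points, so removing them, and 0, leaves [E] with
   [a + B] up to 0. *)
pose L : {set W} := 0%R |: (cos :\: F0).
have cL : #|L| <= xi.+1.
  rewrite cardsU1 (leq_trans (leq_add (leq_b1 _) (leqnn _))) // add1n ltnS.
  rewrite cardsD (setIidPr F0cos) !card_translate card_vset.
  by move: EH cX cAB cE; clear; lia.
have FE : (cos :|: E) :\: L \subset E :|: F0.
  apply/subsetP => s; rewrite !inE negb_or negb_and negbK.
  by case: (s \in E); case: (s \in F0); rewrite ?orbT ?orbF //= ?andbF // => /andP[/andP[_ /negPf ->]].
have EF : (E :|: F0) :\ 0%R \subset (cos :|: E) :\: L.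
  apply/subsetP => s; rewrite !inE negb_or negb_and negbK => /andP[-> /=] /orP[sE|sF].
    rewrite sE orbT andbT; apply/orP; right; apply: contraNN aE.
    rewrite !mem_translate inE => scos.
    have -> : (b1 + a = (a + b1 + s) + s)%R by vec2.
    exact: perE.
  by rewrite (subsetP F0cos) // sF.
have cF : 2 * #|X| <= #|(cos :|: E) :\: L| + xi.+1.
  apply: leq_trans (leq_add (subset_leq_card EF) (leqnn _)).
  have e : #|E| + #|B| <= 1 + #|(E :|: F0) :\ 0%R|.
    apply: leq_trans (_ : #|E :|: F0| <= _).
      by rewrite cardsU disjoint_setI0 // cards0 subn0 card_translate.
    by rewrite (cardsD1 0%R (E :|: F0)) leq_add2r leq_b1.
  rewrite -(leq_add2l 1) addnA (leq_trans _ (leq_add e (leqnn xi.+1))) //.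
  by move: cE cAB; clear; lia.
apply: (nc (sumset (a + b1 |: R)%R (vset H) :\: L)).
  rewrite cosE; apply: subset_trans FE _; apply: subset_trans sAB; rewrite subUset.
  apply/andP; split; first exact/subsetP.
  by apply/subsetP => s /imsetP[b bB ->]; rewrite mem_sumset.
apply: (@cheap_cosets _ N (sspan X) H _ _ p.+1 xi.+1); rewrite ?n0 ?pN ?xiN //.
- rewrite subUset sub1set (subset_trans RE EU) andbT; apply: SS.
    exact: (subsetP AU).
  exact: (subsetP BU).
- rewrite subUset sub1set inE mem0v /=; apply: subset_trans (subsetDl _ _) _.
  apply/subsetP => s; rewrite mem_translate inE => h.
  rewrite -(addKv (a + b1)%R s) inE; apply: memvD.
    by apply: memvD; rewrite -vsetP; [apply: (subsetP AU) | apply: (subsetP BU)].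
  exact: (subvP HU).
- by apply/set0Pn; exists 0%R; rewrite !inE eqxx.
- by rewrite (leq_trans (leq_card_setU _ _)) // cards1 add1n ltnS.
- rewrite cosE -/r addn1 -(leq_add2r xi.+2) (leq_trans cost2) //.
  by apply: leq_trans (leq_trans cF _); rewrite ?leq_add2l // leq_mul2l cX leqnSn.
Qed.
End Doubling.

(** * Choice of the parameters *)

Lemma linear_leq_exp c d : 0 < d -> exists k0, forall k, k0 <= k -> c * k <= 2 ^ (k %/ d).
Proof.
move=> d0; exists (d * (4 * d * c).+2) => k hk; set h := k %/ d.
have hh : (4 * d * c).+2 <= h by rewrite leq_divRL // mulnC.
have kh : k < h.+1 * d by apply: ltn_ceil.
have e1 := ltn_expl h./2 (ltnSn 1).
have e3 := odd_double_half h.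
have e2 : 2 ^ h./2 * 2 ^ h./2 <= 2 ^ h.
  by rewrite -expnD leq_pexp2l // addnn; move: e3; case: (odd h); clear; lia.
apply: leq_trans e2; apply: leq_trans (_ : h./2.+1 * h./2.+1 <= _); last exact: leq_mul.
have kg : k <= 2 * d * h./2.+1.
  apply: leq_trans (ltnW kh) _; rewrite -mulnA [d * _]mulnC mulnA leq_mul2r; apply/orP; right.
  by move: e3; case: (odd h); clear; lia.
have cg : 2 * d * c <= h./2.+1.
  by move: hh e3; rewrite -!mulnA; case: (odd h); clear; lia.
apply: leq_trans (leq_mul (leqnn c) kg) _; rewrite mulnA [c * _]mulnC.
by rewrite leq_mul2r cg orbT.
Qed.

Lemma popular_numerics n r t m f x : 0 < n -> 0 < r -> r <= n -> 0 < t ->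
  129 * n <= x -> t * (128 * r) <= x -> x < t.+1 * (128 * r) -> m <= x %/ t + 1 ->
  f = n * r.+1 + (m + 128 * n) * r + n.+1 ->
  [/\ m <= 257 * n, 2 * f <= 778 * n * r & 2 * t * f <= 128 * n * (x %/ 16)].
Proof.
move=> n0 r0 rn t0 nx tx xt hm ef.
have m257 : m <= 257 * n.
  apply: leq_trans hm _; rewrite addn1 (leq_trans (_ : _ <= 256 * r + 1)) //; last by move: rn n0; clear; lia.
  rewrite addn1 ltnS -ltnS ltn_divLR // (leq_trans xt) // (_ : 128 * r = r * 128); last exact: mulnC.
  by rewrite mulSn mulnA; move: (leq_mul t0 (leqnn r)); rewrite mul1n mulSn; clear; lia.
have x1 : 0 < n * r by rewrite muln_gt0 n0.
have x2 : n <= n * r by rewrite leq_pmulr.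
have x3 : m * r <= 257 * (n * r) by rewrite mulnA leq_mul2r m257 orbT.
have f389 : f <= 389 * (n * r).
  by rewrite ef mulnS mulnDl -mulnA; move: x1 x2 x3; clear; lia.
split=> //; first by rewrite -mulnA; move: f389; clear; lia.
rewrite -(@leq_pmul2r 128) //; apply: leq_trans (_ : 778 * n * x <= _).
  apply: leq_trans (_ : 2 * t * (389 * (n * r)) * 128 <= _).
    by rewrite leq_mul2r leq_mul2l f389 orbT.
  have -> : 2 * t * (389 * (n * r)) * 128 = 778 * n * (t * (128 * r)).
    by clear; lia.
  by rewrite leq_mul2l tx orbT.
have e : 778 * x <= 128 * 128 * (x %/ 16).
  have := ltn_ceil x (isT : 0 < 16); have : 129 <= x by move: nx n0; clear; lia.
  by move: (x %/ 16) => y; clear; lia.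
by have := leq_mul (leqnn n) e; clear; lia.
Qed.

(** * Rank linear in [k] at concrete parameters *)

Section LargeRank.
Variable n : nat.
Local Notation W := 'rV['F_2]_n.
Implicit Types X B P : {set W}.

Lemma popular_structure_num X k : 0 < n -> #|X| = (2 ^ k).+1 -> 500 * n <= 2 ^ k ->
  no_cheap (2 ^ k) X ->
  exists B P, [/\ B \subset X, #|B| <= 128 * n, #|P| <= 778 * n * \dim (sspan X) &
    forall x, x \in X :\: B -> #|[set x' in X | (x + x')%R \notin P]| < #|X| %/ 16].
Proof.
move=> n0 cX nM nc; set r := \dim (sspan X).
have rn : r <= n := dim_leq _.
have nX : 129 * n <= #|X| by rewrite cX; move: nM; clear; lia.
have r0 : 0 < r.
  rewrite lt0n; apply/eqP => r00; have := subset_leq_card (sub_vset X).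
  by rewrite card_vset -/r r00; move: nX n0; clear; lia.
(* This cap makes [m = O(r)], so the cost [f] is [O(n r)] and [t f] is [O(n |X|)]. *)
pose t := #|X| %/ (128 * r); pose m := (#|X| %/ t).+1.
have X0 : X != set0 by rewrite -card_gt0 cX.
have r128 : 0 < 128 * r by rewrite muln_gt0.
have t0 : 0 < t by rewrite divn_gt0 //; move: rn nX; clear; lia.
have tr : t * (128 * r) <= #|X| by apply: leq_trunc_div.
have ceil : #|X| < t.+1 * (128 * r) by apply: ltn_ceil.
have hm : m <= #|X| %/ t + 1 by rewrite addn1.
have mt : #|X| <= m * t by apply/ltnW/ltn_ceil.
have [m257 f778 f2] := popular_numerics n0 r0 rn t0 nX tr ceil hm erefl.
have [||B [P [BX By cP hP]]] := @popular_structure n X (2 ^ k) (128 * n) m t (#|X| %/ 16) _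
  n0 X0 nc erefl t0 f2 mt.
- by move: nM; clear; lia.
- by move: nM m257; clear; lia.
by exists B, P; split=> //; apply: leq_trans (ltnW cP) _.
Qed.

(** The degrees are [q %/ 4] at [X] and [k %/ c] at [P], with [q] about [r / 4] directions. Since
    [p = O(n r)] and [n k <= 2 x], a large constant [c] brings the term of [P] below half of [q x];
    the others take at most a quarter and a sixteenth. *)
Lemma rank_numerics q r x c p k l : 0 < n -> n * k <= 2 * x -> p <= 778 * n * r ->
  r <= n -> 125 * 125 <= c -> 8 * c <= k -> 100 * l.+1 * k <= r -> 0 < l ->
  q = (r %/ 4).-1 -> let J := k %/ c %/ 4 in
  [/\ 4 * q.+1 <= r, q %/ 4 * x + k %/ c * p + q * (x %/ 16) < q * x, k <= 8 * c * J,
      J.*2.*2 <= k %/ c & J.*2 * l.+1 <= q %/ 4].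
Proof.
move=> n0 nk hp rn hc kc hr l0 qE J.
have c0 : 0 < c by apply: leq_trans hc.
have k8 : 8 <= k by apply: leq_trans kc; rewrite -{1}[8]muln1 leq_mul2l c0.
have rk : 200 * k <= r by apply: leq_trans hr; rewrite leq_mul2r; apply/orP; right; lia.
have r4 : r < (r %/ 4).+1 * 4 by apply: ltn_ceil.
have q4 : q.+1 = r %/ 4 by rewrite qE prednK //; move: r4 rk k8; clear; lia.
have rq : r <= 5 * q by rewrite -q4 in r4; move: r4 rk k8; clear; lia.
have q0 : 0 < q by move: rq rk k8; clear; lia.
set d := k %/ c; have dc : d * c <= k by apply: leq_trunc_div.
have kd : k < d.+1 * c by apply: ltn_ceil.
have d8 : 8 <= d by rewrite leq_divRL.
have Jd : J * 4 <= d by apply: leq_trunc_div.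
have dJ : d < J.+1 * 4 by apply: ltn_ceil.
have Jk : J <= k by apply: leq_trans (leq_div _ _) (leq_div _ _).
have x0 : 0 < x by move: (leq_mul n0 k8) nk; rewrite mul1n; clear; lia.
split.
- by rewrite q4 mulnC leq_trunc_div.
(* The size of [c] comes from here: [125 * 125 >= 2 * 778 * 10]. *)
- have dn : 778 * 10 * (d * n) <= x.
    have : 125 * 125 * (d * n) <= 2 * x.
      apply: leq_trans nk; rewrite mulnA mulnC leq_mul2l (leq_trans _ dc) ?orbT //.
      by rewrite mulnC leq_mul2l hc orbT.
    by clear; lia.
  have dp : 2 * (d * p) <= q * x.
    apply: leq_trans (_ : 2 * (d * (778 * n * (5 * q))) <= _).
      by rewrite !leq_mul2l (leq_trans hp) ?orbT // leq_mul2l rq orbT.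
    by apply: leq_trans (leq_mul (leqnn q) dn); clear; lia.
  have e1 : 4 * (q %/ 4 * x) <= q * x.
    by rewrite mulnA leq_mul2r [4 * _]mulnC leq_trunc_div orbT.
  have e2 : 16 * (q * (x %/ 16)) <= q * x.
    by rewrite mulnCA leq_mul2l [16 * _]mulnC leq_trunc_div orbT.
  have e3 : 0 < q * x by rewrite muln_gt0 q0.
  by move: dp e1 e2 e3; clear; lia.
- apply: leq_trans (ltnW kd) _; rewrite mulnAC leq_mul2r; apply/orP; right.
  by move: dJ d8; clear; lia.
- by move: Jd; clear; lia.
rewrite leq_divRL // -mul2n; apply: leq_trans (_ : 8 * (k * l.+1) <= _).
  by rewrite -mulnA [_ * 4]mulnC mulnA -[2]/(2) -mulnA !mulnA; move: (leq_mul Jk (leqnn l.+1)); clear; lia.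
by move: hr rq; clear; lia.
Qed.

Lemma leq_pow2r a b m : a <= b -> a ^ m <= b ^ m.
Proof. by move=> ab; elim: m => // m IHm; rewrite !expnS leq_mul. Qed.

(** For larger rank, [path_contradiction] with [l = 2 ^ (8 c)] would give
    [2 ^ k <= 2 ^ (8 c J) = l ^ J < 10 n]. *)
Lemma rank_linear X B P k c : 0 < n -> #|X| = (2 ^ k).+1 -> n * k <= 2 * 2 ^ k ->
  500 * n <= 2 ^ k -> no_cheap (2 ^ k) X ->
  B \subset X -> #|B| <= 128 * n -> #|P| <= 778 * n * \dim (sspan X) ->
  (forall x, x \in X :\: B -> #|[set x' in X | (x + x')%R \notin P]| < #|X| %/ 16) ->
  125 * 125 <= c -> 8 * c <= k ->
  \dim (sspan X) < 100 * (2 ^ (8 * c)).+1 * k.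
Proof.
move=> n0 cX nk nM nc BX cB cP hP hc kc; rewrite ltnNge; apply/negP.
have : 2 ^ (8 * c) <= 2 ^ (8 * c) by [].
have : 0 < 2 ^ (8 * c) by rewrite expn_gt0.
move: {1 3 4}(2 ^ (8 * c)) => l l0 hl Ckr; set r := \dim (sspan X) in cP Ckr.
have rn : r <= n := dim_leq _.
pose q := (r %/ 4).-1; pose J := k %/ c %/ 4.
have nk' : n * k <= 2 * #|X| by rewrite cX; move: nk; clear; lia.
have [hq hd hJ hJ1 hJ2] := rank_numerics n0 nk' cP rn hc kc Ckr l0 erefl.
(* From [4 (q + 1) <= r], the codimension of such a [V] is at least three times its dimension. *)
have sub V : \dim V <= q.+1 -> #|X :&: vset V| < 10 * n.
  move=> dV; apply: (dense_subspace n0 nc erefl (subnKC _)) => //; rewrite -/r;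
  by move: dV hq nM; clear; lia.
have qX : q <= \dim (sspan (X :\: B)).
  rewrite leqNgt; apply/negP => lt; have := sub (sspan (X :\: B)) (leqW (ltnW lt)).
  rewrite ltnNge => /negP[]; apply: leq_trans (_ : #|X :\: B| <= _).
    by rewrite cardsD (setIidPr BX) cX; move: cB nM; clear; lia.
  by apply: subset_leq_card; rewrite subsetI subsetDl sub_vset.
have := path_contradiction sub hP qX (leqnn _) hd hJ1 hJ2.
apply/negP; rewrite -leqNgt; apply: leq_trans (_ : 2 ^ k <= _); first by move: nM; clear; lia.
apply: leq_trans (_ : 2 ^ (8 * c * J) <= _); first by rewrite leq_pexp2l.
by rewrite expnM; apply: leq_pow2r.
Qed.
End LargeRank.

(** The description costs about [n k + 2 ^ d], at most [(2 + 2 C) 2 ^ k] up to lower terms, while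
    [x' j >= (4 + 4 C) 2 ^ k]; this dictates [j = 8 + 8 C]. *)
Lemma span_numerics n k x' C d j : 0 < n -> n * k <= 2 * 2 ^ k -> 2 ^ k <= 2 * x' ->
  100 * (C + j + 2) <= k -> j = 8 + 8 * C -> 2 ^ d <= C * (2 ^ k).+1 ->
  n * (d + j) + 2 ^ d + n.+1 <= x' * j.
Proof.
move=> n0 nk hx hk ej hd.
have M0 : 0 < 2 ^ k by rewrite expn_gt0.
have hd2 : 2 ^ d <= C * (2 * 2 ^ k).
  by apply: leq_trans hd _; rewrite leq_mul2l; apply/orP; right; move: M0; clear; lia.
have dk : d <= k + C + 1.
  rewrite -(leq_exp2l _ _ (ltnSn 1)) (leq_trans hd2) //.
  have -> : 2 ^ (k + C + 1) = 2 ^ C * (2 * 2 ^ k) by rewrite addnAC addn1 addnC expnD expnS.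
  by rewrite leq_mul2r ltnW ?orbT // ltn_expl.
have n1 : n * (100 * (C + j + 2)) <= 2 * 2 ^ k.
  by apply: leq_trans nk; rewrite leq_mul2l hk orbT.
have n2 : n * (d + j) <= n * k + n * (C + j + 1).
  by rewrite -mulnDr leq_mul2l; apply/orP; right; move: dk; clear; lia.
have xj : 2 ^ k * j <= 2 * (x' * j) by rewrite mulnA leq_mul2r hx orbT.
have ej' : 2 ^ k * j = 8 * 2 ^ k + 8 * (C * 2 ^ k) by rewrite ej mulnDr; clear; lia.
by move: n1 n2 xj ej' hd2 M0 nk; clear; lia.
Qed.

(** With [h] about [k / 8], the sizes [m], [p], [xi] and [bm] are all at most [2 ^ (k - h)], so
    multiplying them by [r <= 2 k] still leaves [o(2 ^ k)]. The exponents make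
    [m u bm = 16 * 2 ^ (2 k)] and [u C 2 ^ k = xi bm]. *)
Lemma final_numerics n k e C r m p xi u bm h : 0 < n -> n * k * e.+1 <= 2 * e * 2 ^ k ->
  n * k <= 2 * 2 ^ k -> r <= n ->
  2 ^ r <= C * 2 ^ k -> 2 * e.+1 * (C + 2) <= k -> h = k %/ 8 -> 1 < h ->
  (20 * e.+1 + 2 * C) * k <= 2 ^ h ->
  m = 16 * 2 ^ (4 * h) -> bm = 2 ^ (k - h) -> u = 2 ^ (k - 3 * h) ->
  xi = C * 2 ^ (k - 2 * h) -> p = C * 2 ^ h ->
  [/\ 0 < u <= (2 ^ k).+1, 4 * (2 ^ k).+1 ^ 2 <= m * u * bm,
   n * r.+1 + (m + bm) * r + n.+1 + bm + bm <= 2 * (2 ^ k).+1,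
   u * 2 ^ r <= xi * bm & [/\ 2 * xi <= bm, 0 < bm, 2 ^ r <= p * bm,
   n * r.+1 + r ^ 2 + (p.+1 + xi.+1) * r + n.+1 + xi.+2 <= 2 * 2 ^ k &
   [&& m <= 2 ^ k, bm <= 2 ^ k, p < 2 ^ k & xi < 2 ^ k]]].
Proof.
move=> n0 nke nk rn rC Ck eh h1 hexp em eb eu ex ep.
have k8 : 8 * h <= k by rewrite mulnC eh leq_trunc_div.
have k0 : 0 < k by move: k8 h1; clear; lia.
have C2 : 2 * C <= 2 ^ h.
  by apply: leq_trans hexp; rewrite -{1}[2 * C]muln1 leq_mul //; clear; lia.
have ek : 20 * e.+1 * k <= 2 ^ h.
  by apply: leq_trans hexp; rewrite leq_mul2r leq_addr orbT.
have bm0 : 0 < bm by rewrite eb expn_gt0.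
have bh : bm * 2 ^ h = 2 ^ k by rewrite eb -expnD subnK //; move: k8; clear; lia.
have h0 : 0 < 2 ^ h by rewrite expn_gt0.
have bM : bm <= 2 ^ k by rewrite eb leq_pexp2l // leq_subr.
have xi2 : 2 * xi <= bm.
  rewrite ex mulnA (leq_trans (leq_mul C2 (leqnn _))) // -expnD eb leq_pexp2l //.
  by move: k8; clear; lia.
have mb : m <= bm.
  by rewrite em eb -[16]/(2 ^ 4) -expnD leq_pexp2l //; move: k8 h1; clear; lia.
have pb : p <= bm.
  rewrite ep eb; apply: leq_trans (_ : 2 ^ h * 2 ^ h <= _).
    by rewrite leq_mul2r (leq_trans _ C2) ?orbT //; clear; lia.
  by rewrite -expnD leq_pexp2l //; move: k8; clear; lia.
have b2 : 2 * bm <= 2 ^ k.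
  by rewrite -bh mulnC leq_mul2l (leq_trans _ (ltn_expl h (ltnSn 1))) ?orbT // (leq_trans h1).
have rk : r <= k + C.
  rewrite -(leq_exp2l _ _ (ltnSn 1)) (leq_trans rC) // expnD mulnC leq_mul2l ltnW ?orbT //.
  exact: ltn_expl.
have Ck' : C <= k by apply: leq_trans Ck; clear; nia.
have r2k : r <= 2 * k by move: rk Ck'; clear; lia.
have kb : k <= bm.
  apply: leq_trans (_ : 2 ^ h <= _); last by rewrite eb leq_pexp2l //; move: k8; clear; lia.
  by apply: leq_trans ek; rewrite -mulnA -{1}[k]mul1n mulnA leq_mul.
(* The hypothesis leaves [2 * 2 ^ k / (e + 1)] of room: half pays for [n (C + 2)], half for the
   lower order terms. *)
have main : n * k + n * (C + 2) + 20 * (k * bm) <= 2 * 2 ^ k.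
  rewrite -(leq_pmul2r (ltn0Sn e)) !mulnDl.
  have e1 : n * (C + 2) * e.+1 <= 2 ^ k.
    have : n * (2 * e.+1 * (C + 2)) <= 2 * 2 ^ k by apply: leq_trans nk; rewrite leq_mul2l Ck orbT.
    by clear; lia.
  have e2 : 20 * (k * bm) * e.+1 <= 2 ^ k.
    by rewrite -bh; apply: leq_trans (leq_mul (leqnn bm) ek); clear; lia.
  by move: nke e1 e2; clear; lia.
have nr : n * r.+1 + n.+1 <= n * k + n * (C + 2) + 1.
  have : n * r <= n * k + n * C by rewrite -mulnDr leq_mul2l rk orbT.
  by rewrite mulnDr mulnS; clear; lia.
have kb1 : bm <= k * bm by rewrite leq_pmull.
have kb2 : k * k <= k * bm by rewrite leq_mul2l kb orbT.
have prod y : y <= bm -> y * r <= 2 * (k * bm).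
  by move=> yb; apply: leq_trans (leq_mul yb r2k) _; clear; lia.
split.
- by rewrite eu expn_gt0 /= (leq_trans _ (leqnSn _)) // leq_pexp2l // leq_subr.
- apply: leq_trans (_ : 16 * (2 ^ k * 2 ^ k) <= _).
    have := expn_gt0 2 k; rewrite /=; move: (2 ^ k) => M M0.
    by have := leq_mul (_ : M.+1 <= 2 * M) (_ : M.+1 <= 2 * M); rewrite -mulnn; move=> /(_ ltac:(lia) ltac:(lia)); clear; lia.
  rewrite em eu eb -!mulnA leq_mul2l -!expnD leq_pexp2l //; move: k8; clear; lia.
- have := prod _ mb; have := prod _ (leqnn bm); rewrite mulnDl.
  by move: nr main kb1; clear; lia.
- apply: leq_trans (leq_mul (leqnn u) rC) _.
  rewrite ex eb eu mulnCA -mulnA leq_mul2l -!expnD leq_pexp2l ?orbT //; move: k8; clear; lia.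
split=> //.
- by rewrite ep -mulnA [_ ^ h * _]mulnC bh.
- have xb : xi <= bm by move: xi2; clear; lia.
  have := prod _ xb; have := prod _ pb; have : r * r <= 4 * (k * bm).
    by apply: leq_trans (leq_mul r2k r2k) _; move: kb2; clear; lia.
  rewrite -mulnn mulnDl ![_.+1 * r]mulSn.
  by move: nr main kb1 xb r2k kb bm0 k0 kb2; clear; lia.
apply/and4P; split=> //.
- exact: leq_trans bM.
- by move: pb b2 bm0; clear; lia.
- by move: xi2 b2 bm0; clear; lia.
Qed.

Lemma popular_structure_rank : exists C k0, forall k n (X : {set 'rV['F_2]_n}),
  k0 <= k -> 0 < n -> n * k <= 2 * 2 ^ k -> #|X| = (2 ^ k).+1 -> no_cheap (2 ^ k) X ->
  exists B P : {set 'rV['F_2]_n}, [/\ B \subset X, #|B| <= 128 * n, #|P| <= 778 * n * \dim (sspan X),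
    forall x, x \in X :\: B -> #|[set x' in X | (x + x')%R \notin P]| < #|X| %/ 16 &
    \dim (sspan X) < C * k].
Proof.
have [c hc] : exists c, 125 * 125 <= c by exists (125 * 125).
exists (100 * (2 ^ (8 * c)).+1), (8 * c + 1000) => k n X hk n0 nk cX nc.
have nM : 500 * n <= 2 ^ k.
  have : n * 1000 <= n * k by rewrite leq_mul2l (leq_trans _ hk) ?orbT // leq_addl.
  by move: nk; clear; lia.
have [B [P [BX cB cP hP]]] := popular_structure_num n0 cX nM nc.
exists B, P; split=> //; apply: rank_linear cP hP hc _ => //.
by apply: leq_trans hk; rewrite leq_addr.
Qed.

Lemma rank_bounded : exists C k0, forall k n (X : {set 'rV['F_2]_n}),
  k0 <= k -> 0 < n -> n * k <= 2 * 2 ^ k -> #|X| = (2 ^ k).+1 -> no_cheap (2 ^ k) X ->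
  2 ^ \dim (sspan X) <= C * 2 ^ k.
Proof.
have [C1 [k1 rl]] := popular_structure_rank.
(* [C3] bounds [|P| / 2 ^ k] through [778 n r <= 778 C1 n k]; [K = 4 C3 ^ 2] because both factors
   dividing [|P| ^ 2] are at least [2 ^ k / 2]. *)
have [C3 eC3] : exists C3, C3 = 2 * 778 * C1 by eexists.
have [K eK] : exists K, K = 4 * C3 ^ 2 by eexists.
have [C4 eC4] : exists C4, C4 = K * 2 ^ (K ^ 3) by eexists.
have [j ej] : exists j, j = 8 + 8 * C4 by eexists.
exists (2 * C4 * 2 ^ j), (k1 + 100 * (C4 + j + 2)) => k n X hk n0 nk cX nc.
have hk1 : k1 <= k by apply: leq_trans hk; apply: leq_addr.
have hk2 : 100 * (C4 + j + 2) <= k by apply: leq_trans hk; apply: leq_addl.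
have [B [P [BX cB cP hP rC]]] := rl k n X hk1 n0 nk cX nc.
have M0 : 0 < 2 ^ k by rewrite expn_gt0.
have n512 : 800 * n <= 2 * 2 ^ k.
  apply: leq_trans nk; rewrite mulnC leq_mul2l (leq_trans _ hk2) ?orbT //.
  by rewrite ej; clear; lia.
have cX' : 2 ^ k <= 2 * #|X :\: B|.
  by rewrite cardsD (setIidPr BX) cX; move: cB n512; clear; lia.
have ha : 2 ^ k <= 2 * (#|X| - 2 * (#|X| %/ 16)).
  have : #|X| %/ 16 * 16 <= #|X| by apply: leq_trunc_div.
  by rewrite cX; clear; lia.
apply: leq_trans (_ : C4 * #|X| * 2 ^ j <= _); last first.
  rewrite [2 * C4 * _ * _]mulnAC leq_mul2r cX; apply/orP; right.
  by move: (leq_mul (leqnn C4) M0); clear; lia.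
rewrite eC4; apply: (rank_bound (N := 2 ^ k) (B := B) (P := P)  (a := #|X| %/ 16)) => //.
- by rewrite -card_gt0; move: cX' M0; clear; lia.
- by move: ha M0; clear; lia.
- have cP' : #|P| <= C3 * 2 ^ k.
    apply: leq_trans cP (leq_trans (leq_mul (leqnn _) (ltnW rC)) _); rewrite eC3.
    by move: (leq_mul (leqnn (778 * C1)) nk); clear; lia.
  apply: leq_trans (leq_mul cP' cP') _; rewrite eK.
  move: (leq_mul ha cX'); move: (#|X| - _) #|X :\: B| => u v h.
  by have := leq_mul (leqnn (C3 * C3)) h; rewrite -[C3 ^ 2]mulnn; clear; lia.
by move=> d; rewrite -eC4 cX; apply: span_numerics.
Qed.

Lemma large_set_cheap e : exists k0, forall k n (X : {set 'rV['F_2]_n}),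
  k0 <= k -> 0 < n -> n * k * e.+1 <= 2 * e * 2 ^ k -> #|X| = (2 ^ k).+1 ->
  ~ no_cheap (2 ^ k) X.
Proof.
have [C [k1 rb]] := rank_bounded.
have [k2 hexp] := @linear_leq_exp (20 * e.+1 + 2 * C) 8 isT.
exists (k1 + k2 + 2 * e.+1 * (C + 2) + 16) => k n X hk n0 nke cX nc.
have nk : n * k <= 2 * 2 ^ k.
  by rewrite -(leq_pmul2r (ltn0Sn e)) (leq_trans nke) //; clear; lia.
have rC : 2 ^ \dim (sspan X) <= C * 2 ^ k by apply: rb => //; move: hk; clear; lia.
have [|||hu hm c1 hxi [h2xi b0 hp c2 /and4P[mN bN pN xN]]] := final_numerics n0 nke nk (dim_leq (sspan X)) rC _ erefl _ (hexp k _) erefl erefl erefl erefl erefl.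
- by move: hk; clear; lia.
- by rewrite leq_divRL //; move: hk; clear; lia.
- by move: hk; clear; lia.
rewrite -cX in hu hm c1.
exact: (doubling_contradiction n0 nc cX hu hm c1 hxi h2xi b0 hp c2 mN bN pN xN).
Qed.

(** * Independent subspaces *)

Section MatrixCounts.
Variables k l : nat.

Definition kerset (D : 'M['F_2]_(k, l)) : {set 'rV['F_2]_k} := [set u | (u *m D == 0)%R].

(** A matrix of rank [r] is a product of a [k] by [r] and an [r] by [l] matrix. *)
Lemma card_rank_leq r : #|[set D : 'M['F_2]_(k, l) | \rank D == r]| <= 2 ^ (r * (k + l)).
Proof.
have -> : 2 ^ (r * (k + l)) = #|{: 'M['F_2]_(k, r) * 'M['F_2]_(r, l)}|.
  by rewrite card_prod !card_mx card_Fp2 -expnD mulnDr [k * r]mulnC.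
rewrite -cardsT; apply: leq_trans (leq_imset_card (fun p => p.1 *m p.2)%R _).
apply/subset_leq_card/subsetP => D; rewrite inE => /eqP rD; apply/imsetP.
by subst r; exists (col_base D, row_base D); rewrite // mulmx_base.
Qed.

Lemma card_kernel_leq (D : 'M['F_2]_(k, l)) :
  #|kerset D| <= 2 ^ (k - \rank D).
Proof.
have -> : 2 ^ (k - \rank D) = #|{: 'rV['F_2]_(\rank (kermx D))}|.
  by rewrite card_mx card_Fp2 mul1n mxrank_ker.
rewrite -cardsT; apply: leq_trans (leq_imset_card (fun w => w *m row_base (kermx D))%R _).
apply/subset_leq_card/subsetP => u; rewrite inE => /eqP uD; apply/imsetP.
have /submxP[w ->] : (u <= row_base (kermx D))%MS by rewrite eq_row_base sub_kermx uD.
by exists w.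
Qed.

(** Full rank matrices contribute 2 each, since the kernel is then trivial. For rank [r < k], the
    hypothesis at [i = k - r] bounds the total contribution by [2 ^ (k l - 2 k)]. *)
Lemma sum_kernels : 
  (forall i, 0 < i <= k -> 2 ^ i + k ^ 2 + 2 * k <= i * (k + l)) ->
  (\sum_(D : 'M['F_2]_(k, l)) 2 ^ #|kerset D|) * 2 ^ k
    <= 2 ^ (k * l) * (2 ^ k.+1).+1.
Proof.
move=> hi.
have le D : 2 ^ #|kerset D| <= 2 ^ 2 ^ (k - \rank D).
  by rewrite leq_pexp2l // card_kernel_leq.
apply: leq_trans (_ : (\sum_(D : 'M['F_2]_(k, l)) 2 ^ 2 ^ (k - \rank D)) * 2 ^ k <= _).
  by rewrite leq_mul2r leq_sum ?orbT // => D _.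
pose rk (D : 'M['F_2]_(k, l)) : 'I_k.+1 := inord (\rank D).
have rkE D : nat_of_ord (rk D) = \rank D by rewrite inordK // ltnS rank_leq_row.
rewrite (partition_big rk xpredT) //= big_ord_recr /= mulnDl.
rewrite mulnSr addnC leq_add //.
  rewrite expnS mulnA [_ * 2]mulnC leq_mul2r; apply/orP; right.
  apply: leq_trans (_ : \sum_(D : 'M['F_2]_(k, l)) 2 <= _); last first.
    by rewrite sum_nat_const card_mx card_Fp2 mulnC.
  rewrite big_mkcond leq_sum // => D _; case: eqP => // e.
  by rewrite -rkE e /= subnn.
rewrite big_distrl /=; apply: leq_trans (_ : \sum_(i < k) 2 ^ (k * l - k) <= _); last first.
  rewrite sum_nat_const card_ord; apply: leq_trans (_ : 2 ^ k * 2 ^ (k * l - k) <= _).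
    by rewrite leq_mul2r ltnW ?orbT // ltn_expl.
  rewrite -expnD leq_pexp2l //; have [->|k0] := posnP k; first by rewrite mul0n.
  have := hi k; rewrite k0 leqnn => /(_ isT) h; rewrite subnKC // leq_pmulr //.
  rewrite lt0n; apply/eqP => l0; move: h k0; rewrite l0 addn0 -[k ^ 2]mulnn.
  by clear; lia.
apply: leq_sum => r _.
have rk' : 0 < k - r by rewrite subn_gt0.
have := hi (k - r); rewrite rk' leq_subr => /(_ isT) h.
apply: leq_trans (_ : 2 ^ (r * (k + l)) * 2 ^ 2 ^ (k - r) * 2 ^ k <= _).
  rewrite leq_mul2r; apply/orP; right; apply: leq_trans (leq_mul (card_rank_leq r) (leqnn _)).
  rewrite -sum_nat_const [X in _ <= X](eq_bigl (fun D : 'M['F_2]_(k,l) => \rank D == r)); last by move=> D; rewrite inE.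
  rewrite [X in X <= _](eq_bigl (fun D : 'M['F_2]_(k,l) => \rank D == r)); last first.
    by move=> D; rewrite -val_eqE /= rkE.
  by apply: leq_sum => D /eqP ->.
rewrite -!expnD leq_pexp2l // -(leq_add2r (k + k ^ 2)).
have rk2 : r <= k by apply: ltnW.
move: h; rewrite mulnBl; have : r * (k + l) <= k * (k + l) by rewrite leq_mul2r rk2 orbT.
rewrite [k * (k + l)]mulnDr mulnn; move: (2 ^ (k - r)) (r * (k + l)) (k * l) (k ^ 2) => a b c d.
clear; lia.
Qed.
End MatrixCounts.

Lemma cauchy_schwarz_nat (T : finType) (N : T -> nat) :
  (\sum_A N A) ^ 2 <= #|[set A | 0 < N A]| * \sum_A N A ^ 2.
Proof.
pose P := [set A | 0 < N A].
have e1 : \sum_A N A = \sum_(A in P) N A.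
  rewrite [RHS]big_mkcond; apply: eq_bigr => A _; rewrite inE; case: posnP => //.
have e2 : \sum_A N A ^ 2 = \sum_(A in P) N A ^ 2.
  by rewrite [RHS]big_mkcond; apply: eq_bigr => A _; rewrite inE; case: posnP => // ->.
rewrite e1 e2 -(@leq_pmul2l 2) // -mulnn big_distrlr /= big_distrr /=.
apply: leq_trans (_ : \sum_(A in P) \sum_(B in P) (N A ^ 2 + N B ^ 2) <= _).
  apply: leq_sum => A _; rewrite big_distrr /=; apply: leq_sum => B _; exact: nat_Cauchy.
under eq_bigr do rewrite big_split /= sum_nat_const.
by rewrite big_split /= sum_nat_const -big_distrr /= mul2n -addnn.
Qed.

(** * Second moment over graphs of linear maps *)

Section SecondMoment.
Variables k l : nat.
Local Notation W := 'rV['F_2]_(k + l).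

Definition graph (D : 'M['F_2]_(k, l)) : {set W} :=
  [set row_mx u (u *m D)%R | u : 'rV['F_2]_k].

Lemma card_graph D : #|graph D| = 2 ^ k.
Proof.
rewrite card_imset ?cardsT ?card_mx ?card_Fp2 ?mul1n //.
by move=> u v /eq_row_mx[].
Qed.

Lemma graph0 D : 0%R \in graph D.
Proof. by apply/imsetP; exists 0%R; rewrite // mul0mx row_mx0. Qed.

Lemma card_graphI D D' :
  #|graph D :&: graph D'| = #|kerset (D - D')%R|.
Proof.
rewrite -(card_imset (kerset (D - D')%R)
  (f := fun u => row_mx u (u *m D)%R)); last by move=> u v /eq_row_mx[].
apply: eq_card => x; rewrite inE; apply/andP/imsetP.
  move=> [/imsetP[u _ ->] /imsetP[v _ /eq_row_mx[e1 e2]]]; exists u => //.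
  by rewrite inE mulmxBr e2 e1 subrr.
move=> [u]; rewrite inE mulmxBr subr_eq0 => /eqP e ->; split; first exact: imset_f.
by rewrite e; apply: imset_f.
Qed.

Lemma card_missing (F : {set W}) : 0%R \in F ->
  #|[set A : {set W} | [disjoint F :\ 0%R & A]]| * 2 ^ #|F| = 2 ^ (2 ^ (k + l)).+1.
Proof.
move=> F0; have -> : [set A : {set W} | [disjoint F :\ 0%R & A]] = powerset (~: (F :\ 0%R)).
  by apply/setP => A; rewrite !inE disjoint_sym disjoints_subset.
have cW : #|{: W}| = 2 ^ (k + l) by rewrite card_mx card_Fp2 mul1n.
rewrite card_powerset -expnD; congr (2 ^ _); rewrite -cW -(cardsC (F :\ 0%R)).
by rewrite (cardsD1 0%R F) F0 add1n addnS addnC.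
Qed.

(** [N A] counts the graphs that are independent for [A]. Two graphs meet in a copy of the kernel of
    [D - D'], so the second moment over the square of the first is half the average of
    [2 ^ #|kerset D|], at most [1 + 2 ^ -(k + 1)] by [sum_kernels]. Cauchy-Schwarz concludes. *)
Lemma second_moment :
  (forall i, 0 < i <= k -> 2 ^ i + k ^ 2 + 2 * k <= i * (k + l)) ->
  2 ^ 2 ^ (k + l) * 2 ^ k.+1 <=
    #|[set A : {set W} | [exists D, [disjoint graph D :\ 0%R & A]]]| * (2 ^ k.+1).+1.
Proof.
move=> hi; set T := 2 ^ (k + l).
pose N (A : {set W}) := #|[set D | [disjoint graph D :\ 0%R & A]]|.
have -> : [set A : {set W} | [exists D, [disjoint graph D :\ 0%R & A]]] = [set A | 0 < N A].
  apply/setP => A; rewrite !inE; apply/existsP/card_gt0P => -[D]; first by exists D; rewrite inE.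
  by rewrite inE; exists D.
have cM : #|{: 'M['F_2]_(k, l)}| = 2 ^ (k * l) by rewrite card_mx card_Fp2.
have first : (\sum_A N A) * 2 ^ 2 ^ k = 2 ^ (k * l) * 2 ^ T.+1.
  under eq_bigr do rewrite /N -sum1dep_card.
  rewrite (exchange_big_dep xpredT) //= big_distrl /=.
  rewrite -cM -[RHS]sum_nat_const.
  by apply: eq_bigr => D _; rewrite sum1dep_card -(card_graph D) card_missing ?graph0.
have second : (\sum_A N A ^ 2) * 2 ^ (2 * 2 ^ k) = 2 ^ (k * l) * 2 ^ T.+1 *
    \sum_(D : 'M['F_2]_(k, l)) 2 ^ #|kerset D|.
  transitivity (\sum_(D : 'M['F_2]_(k, l)) \sum_(D' : 'M['F_2]_(k, l)) 2 ^ T.+1 * 2 ^ #|kerset (D - D')%R|).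
    have -> : \sum_A N A ^ 2 = \sum_D \sum_D' #|[set A : {set W} | [disjoint (graph D :|: graph D') :\ 0%R & A]]|.
      under eq_bigr do rewrite /N -mulnn -sum1dep_card big_distrlr /=.
      rewrite (exchange_big_dep xpredT) //=; apply: eq_bigr => D _.
      rewrite (exchange_big_dep xpredT) //=; apply: eq_bigr => D' _.
      rewrite muln1 sum1dep_card; apply: eq_card => A; rewrite !inE.
      by rewrite setDUl -!setI_eq0 setIUl setU_eq0.
    rewrite big_distrl /=; apply: eq_bigr => D _; rewrite big_distrl /=; apply: eq_bigr => D' _.
    rewrite /T -(@card_missing (graph D :|: graph D')) ?inE ?graph0 // -mulnA -expnD; congr (_ * 2 ^ _).
    by rewrite -card_graphI cardsUI !card_graph addnn mul2n.
  rewrite -mulnA -cM -[RHS]sum_nat_const.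
  apply: eq_bigr => D _; rewrite -big_distrr /=; congr (_ * _).
  pose h (D' : 'M['F_2]_(k, l)) := (D - D')%R.
  have hI : injective h by apply: inv_inj; apply: subKr.
  by rewrite (reindex_inj hI) /=; apply: eq_bigr => D' _; rewrite /h subKr.
have cs := cauchy_schwarz_nat N; have sk := sum_kernels hi.
set P := #|[set A | 0 < N A]| in cs *.
set S := 2 ^ (k * l) in first second sk; set Z := \sum_(D : 'M['F_2]_(k, l)) _ in second sk.
have S0 : 0 < S by rewrite expn_gt0.
have key : S * 2 ^ T.+1 <= P * Z.
  have ST0 : 0 < S * 2 ^ T.+1 by rewrite muln_gt0 S0 expn_gt0.
  have e : (S * 2 ^ T.+1) ^ 2 = (\sum_A N A) ^ 2 * 2 ^ (2 * 2 ^ k).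
    by rewrite -first expnMn -expnM [2 ^ k * 2]mulnC.
  rewrite -(leq_pmul2r ST0) mulnn e; apply: leq_trans (leq_mul cs (leqnn _)) _.
  by rewrite -mulnA second -[P * Z * _]mulnA [Z * _]mulnC.
rewrite -(leq_pmul2l S0) [S * (P * _)]mulnCA.
apply: leq_trans (_ : P * (Z * 2 ^ k) <= _); last by rewrite leq_mul2l sk orbT.
have -> : S * (2 ^ T * 2 ^ k.+1) = S * 2 ^ T.+1 * 2 ^ k.
  by rewrite !expnS [2 ^ T * _]mulnCA !mulnA.
by rewrite mulnA leq_mul2r key orbT.
Qed.

End SecondMoment.

(** * The chromatic number *)

Section Chromatic.
Variables k l : nat.
Local Notation W := 'rV['F_2]_(k + l).
Implicit Types (A X : {set W}).

(** The element 0 is exempt because edges join distinct vertices. *)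
Definition independent A X := [disjoint sumset X X :\ 0%R & A].

(** The map [q] is linear with kernel [graph D], so its [2 ^ l] fibres are the cosets of an
    independent subspace. *)
Lemma colorable_cosets A (D : 'M['F_2]_(k, l)) :
  [disjoint graph D :\ 0%R & A] -> colorable (cayley_sum_graph A) (2 ^ l).
Proof.
move=> dis; have cQ : #|{: 'rV['F_2]_l}| = 2 ^ l by rewrite card_mx card_Fp2 mul1n.
pose q (x : W) : 'rV['F_2]_l := (rsubmx x - lsubmx x *m D)%R.
apply/existsP; exists [ffun x => cast_ord cQ (enum_rank (q x))].
apply/forallP => x; apply/forallP => y; apply/implyP => /andP[xy xyA].
rewrite !ffunE; apply: contraTneq xyA => /cast_ord_inj/enum_rank_inj e.
apply: contraTN isT => xyA; have := disjointFr dis; move=> /(_ (x + y)%R).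
rewrite xyA !inE addv_eq0 xy /= => h; suff : (true = false) by []; apply: h.
apply/imsetP; exists (lsubmx (x + y)%R) => //.
rewrite -{1}[(x + y)%R]hsubmxK; congr row_mx.
move: e; rewrite /q => /eqP; rewrite -addv_eq0 => /eqP e.
rewrite !linearD /= mulmxDl; apply/eqP; rewrite -subr_eq0; apply/eqP; rewrite -[RHS]e.
by rewrite opprD addrACA.
Qed.

Lemma chromatic_geq A :
  (forall X, #|X| = (2 ^ k).+1 -> ~~ independent A X) ->
  2 ^ l <= chromatic_number (cayley_sum_graph A).
Proof.
move=> indep; rewrite /chromatic_number; case: ex_minnP => c /existsP[f /forallP prop] _.
rewrite leqNgt; apply/negP => cl.
pose cls (i : 'I_c) : {set W} := [set x | f x == i].
have [i big] : exists i, 2 ^ k < #|cls i|.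
  apply/existsP; apply: contraTT cl => /existsPn small; rewrite -leqNgt.
  rewrite -(@leq_pmul2r (2 ^ k)) ?expn_gt0 // -expnD addnC.
  have -> : 2 ^ (k + l) = #|{: W}| by rewrite card_mx card_Fp2 mul1n.
  rewrite -sum1_card (partition_big f xpredT) //= -[c in c * _]card_ord -sum_nat_const.
  apply: leq_sum => i _; have := small i; rewrite -leqNgt; apply: leq_trans.
  by rewrite -sum1_card; apply: eq_leq; apply: eq_bigl => x; rewrite inE.
have [X Xi cX] := ex_subset_card big.
move/negP: (indep X cX); apply; rewrite /independent; apply/pred0P => s /=.
apply/negP => /andP[]; rewrite in_setD1 => /andP[s0 /sumsetP[x [y [xX yX es]]]] sA.
have xy : x != y by rewrite -addv_eq0 -es.
have /forallP/(_ y) := prop x; rewrite /= /cayley_sum_adj xy -es sA /=.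
have /eqP -> : f x == i by have := subsetP Xi x xX; rewrite inE.
have /eqP -> : f y == i by have := subsetP Xi y yX; rewrite inE.
by rewrite eqxx.
Qed.

Lemma chromatic_eq A (D : 'M['F_2]_(k, l)) :
  [disjoint graph D :\ 0%R & A] ->
  (forall X, #|X| = (2 ^ k).+1 -> ~~ independent A X) ->
  chromatic_number (cayley_sum_graph A) = 2 ^ l.
Proof.
move=> dis indep; apply/eqP; rewrite eqn_leq chromatic_geq // andbT.
by rewrite /chromatic_number; case: ex_minnP => c _; apply; apply: colorable_cosets dis.
Qed.
End Chromatic.

(** The value can differ from [2 ^ l] only if no graph is independent or some set of [2 ^ k + 1]
    points is. The second moment and the union bound each allow a proportion of at most [2 ^ -k]. *)
Lemma few_exceptions e : exists k0, forall k l, k0 <= k ->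
  (forall i, 0 < i <= k -> 2 ^ i + k ^ 2 + 2 * k <= i * (k + l)) ->
  (k + l) * k * e.+1 <= 2 * e * 2 ^ k ->
  3 * (k + l).+1 ^ 2 * (2 ^ k).+1 ^ 2 * 2 ^ k <= 2 ^ (k + l) ->
  #|[set A : {set 'rV['F_2]_(k + l)} | chromatic_number (cayley_sum_graph A) != 2 ^ l]| * 2 ^ k
    <= 2 * 2 ^ 2 ^ (k + l).
Proof.
have [k0 large] := large_set_cheap e.
exists k0.+1 => k l hk hi hke hn.
have n0 : 0 < k + l by rewrite (leq_trans _ (leq_addr _ _)) // (leq_trans _ hk).
pose T := 2 ^ 2 ^ (k + l).
pose good := [set A : {set 'rV['F_2]_(k + l)} | [exists D : 'M['F_2]_(k, l), [disjoint graph D :\ 0%R & A]]].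
pose bad (A : {set 'rV['F_2]_(k + l)}) :=
  [exists X : {set 'rV['F_2]_(k + l)}, (#|X| == (2 ^ k).+1) && independent A X].
have cT : #|{: {set 'rV['F_2]_(k + l)}}| = T.
  by rewrite -cardsT -powersetT card_powerset cardsT card_mx card_Fp2 mul1n.
have sub : [set A : {set 'rV['F_2]_(k + l)} | chromatic_number (cayley_sum_graph A) != 2 ^ l] \subset
    ~: good :|: [set A | bad A].
  apply/subsetP => A; rewrite !inE; apply: contraR; rewrite negb_or negbK => /andP[/existsP[D dis] nb].
  apply/eqP; apply: chromatic_eq dis _ => X cX; apply/negP => ind; move/negP: nb; apply.
  by apply/existsP; exists X; rewrite cX eqxx.
have b1 : #|~: good| * 2 ^ k <= T.
  have := second_moment hi; rewrite -/T -/good => sm.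
  have cg : #|good| + #|~: good| = T by rewrite cardsC.
  have : #|~: good| * (2 ^ k.+1).+1 <= T.
    move: sm; rewrite -cg; move: #|good| #|~: good| (2 ^ k.+1) => a b c; clear.
    by rewrite !mulnDl !mulnS; lia.
  apply: leq_trans; rewrite leq_mul2l expnS; apply/orP; right; clear; lia.
have b2 : #|[set A | bad A]| * 2 ^ k <= T.
  have := @cheap_union_bound (k + l) (2 ^ k) bad; rewrite -/T => ub.
  rewrite -(@leq_pmul2r (2 ^ (k + l))) ?expn_gt0 // mulnAC.
  apply: leq_trans (leq_mul (ub _) (leqnn _)) _; last first.
    by rewrite mulnAC [T * _]mulnC leq_mul2r hn orbT.
  move=> A /existsP[X /andP[/eqP cX ind]]; apply: boolp.contrapT => no.
  apply: (large k (k + l) X (ltnW hk) n0 hke cX) => F FX ch; apply: no; exists F => //.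
  by apply: disjointWl ind; apply: setSD.
apply: leq_trans (leq_mul (subset_leq_card sub) (leqnn _)) _.
apply: leq_trans (leq_mul (leq_card_setU _ _) (leqnn _)) _.
by rewrite mulnDl mul2n -addnn leq_add.
Qed.

(** * Integers with [n log n] just below a power of two *)

Definition ilog (n : nat) := trunc_log 2 n.

Lemma ilogP n : 0 < n -> 2 ^ ilog n <= n < 2 ^ (ilog n).+1.
Proof. by move=> n0; apply: trunc_log_bounds. Qed.

(* [n log n] is within a factor [1 + O(1 / e)] below a power of two. *)
Definition near_power (e n : nat) : bool :=
  e * 2 ^ (ilog (n * ilog n)).+1 < (e + 2) * n * (ilog n).+1.

(** The ratio [2 ^ i / i] is nondecreasing for [i >= 1]. *)
Lemma exp_convex k i : 0 < i <= k -> 2 ^ i * k <= i * 2 ^ k.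
Proof.
case/andP => i0; elim: k => [|k IHk]; first by rewrite leqn0 => /eqP ->.
rewrite leq_eqVlt => /orP[/eqP -> //|]; first by rewrite mulnC.
rewrite ltnS => ik; have := IHk ik.
rewrite expnS mulnS; have : 2 ^ i <= 2 ^ i * k by rewrite leq_pmulr // (leq_trans i0).
by rewrite mulnCA; clear; lia.
Qed.

(** The two bounds on [n] and [k] are what is used of [k = floor (log n + log log n)]. Being away
    from a power of two absorbs the difference between [k] and [log n]. *)
Lemma few_exceptions_near e : exists N, forall n k, N <= n ->
  n * ilog n < 2 ^ k.+1 -> 2 ^ k <= n * (ilog n).+1 -> ~~ near_power e n ->
  (k <= n) /\
  #|[set A : {set 'rV['F_2]_n} | chromatic_number (cayley_sum_graph A) != 2 ^ (n - k)]| * n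
    <= 2 ^ 2 ^ n.
Proof.
have [k0 few] := few_exceptions e.
have [m1 lin1] := @linear_leq_exp 1 e.+1 isT.
have [m2 lin2] := @linear_leq_exp 48 8 isT.
have [m3 lin3] := @linear_leq_exp 40 3 isT.
exists (2 ^ (k0 + m1 + m3 + 8) + m2) => n k nN nk1 nk2 near.
have n0 : 0 < n by apply: leq_trans nN; rewrite addn_gt0 expn_gt0.
set i := ilog n in nk1 nk2.
have /andP[in1 in2] : 2 ^ i <= n < 2 ^ i.+1 := ilogP n0.
have hi : k0 + m1 + m3 + 8 <= i.
  rewrite -ltnS -(ltn_exp2l _ _ (ltnSn 1)); apply: leq_ltn_trans in2.
  by apply: leq_trans nN; apply: leq_addr.
have i8 : 8 <= i by move: hi; clear; lia.
have ik : i + 3 < k.+1.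
  rewrite -(ltn_exp2l _ _ (ltnSn 1)); apply: leq_ltn_trans nk1; rewrite expnD.
  by apply: leq_mul.
have nearP : (e + 2) * n * i.+1 <= 2 * e * 2 ^ k.
  move: near; rewrite /near_power -/i -leqNgt => near; apply: leq_trans near _.
  rewrite [2 * e]mulnC -mulnA -expnS leq_mul2l; apply/orP; right; rewrite leq_pexp2l //.
  have := trunc_logP (ltnSn 1) (_ : 0 < n * i); rewrite muln_gt0 n0 /= => /(_ (leq_trans _ i8)).
  move=> /(_ isT) h; rewrite ltnS -ltnS -(ltn_exp2l _ _ (ltnSn 1)).
  exact: leq_ltn_trans h nk1.
(* [k] is at most [(1 + 1 / (e + 1)) (i + 1)], because [2 ^ (k - i - 1) <= i + 1 <= 2 ^ q]. *)
set q := i.+1 %/ e.+1.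
have kq : k <= i.+1 + q.
  rewrite leqNgt; apply/negP => lt.
  have : 2 ^ (i.+1 + q).+1 <= 2 ^ i.+1 * i.+1.
    apply: leq_trans (_ : 2 ^ k <= _); first by rewrite leq_pexp2l.
    by apply: leq_trans nk2 _; rewrite leq_mul2r ltnW ?orbT.
  rewrite -addnS expnD leq_pmul2l ?expn_gt0 // expnS.
  have := lin1 i.+1; rewrite mul1n -/q => /(_ _)/leq_trans.
  move=> h1 h2; have : 2 * 2 ^ q <= 2 ^ q by apply: leq_trans h2 (h1 _ _ _) => //; move: hi; clear; lia.
  by have := expn_gt0 2 q; clear; lia.
have ekq : e.+1 * k <= (e + 2) * i.+1.
  apply: leq_trans (leq_mul (leqnn _) kq) _; rewrite mulnDr addn2 [e.+2 * _]mulSn addnC leq_add //.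
  by rewrite mulnC leq_trunc_div.
have hke : n * k * e.+1 <= 2 * e * 2 ^ k.
  by apply: leq_trans nearP; rewrite -!mulnA [(e + 2) * _]mulnCA leq_mul2l [k * _]mulnC ekq orbT.
have k2 : k <= 4 * i.
  have : q <= i.+1 by apply: leq_div.
  by move: kq i8; clear; lia.
have kpos : 0 < k by move: ik; clear; lia.
have k3 : k * (k ^ 2 + 2 * k) <= n.
  apply: leq_trans in1.
  have h3 : 40 * i <= 2 ^ (i %/ 3) by apply: lin3; move: hi; clear; lia.
  have h10 : 10 * k <= 2 ^ (i %/ 3) by apply: leq_trans h3; move: k2; clear; lia.
  apply: leq_trans (_ : (2 ^ (i %/ 3)) ^ 3 <= _); last by rewrite -expnM leq_pexp2l // leq_trunc_div.
  apply: leq_trans (leq_pow2r 3 h10); rewrite !expnS expn0 !muln1.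
  have kk : k <= k * k by rewrite leq_pmulr.
  by have := leq_mul (leqnn k) kk; clear; lia.
have kn : k <= n.
  by apply: leq_trans k3; rewrite leq_pmulr // addn_gt0 expn_gt0 kpos.
have nk3 : 2 ^ k <= n * k.-1.
  by apply: leq_trans nk2 _; rewrite leq_mul2l; apply/orP; right; move: ik; clear; lia.
(* By [exp_convex], [2 ^ j <= j 2 ^ k / k], and [2 ^ k <= n (k - 1)] leaves [j n / k] for the other
   two terms. *)
have cond j : 0 < j <= k -> 2 ^ j + k ^ 2 + 2 * k <= j * n.
  move=> jk; have cv := exp_convex jk; case/andP: jk => j0 jk.
  rewrite -(leq_pmul2r kpos) -addnA mulnDl.
  apply: leq_trans (_ : j * (n * k.-1) + j * n <= _).
    apply: leq_add; first by apply: leq_trans cv _; rewrite leq_mul2l nk3 orbT.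
    by rewrite mulnC; apply: leq_trans k3 _; rewrite leq_pmull.
  by rewrite -mulnDr -mulnA leq_mul2l -mulnSr prednK // leqnn orbT.
have big : 3 * n.+1 ^ 2 * (2 ^ k).+1 ^ 2 * 2 ^ k <= 2 ^ n.
  have Mn : 2 ^ k <= n * n.
    apply: leq_trans nk3 _; rewrite leq_mul2l; apply/orP; right.
    by apply: leq_trans (leq_pred k) kn.
  have h48 : 48 * n <= 2 ^ (n %/ 8) by apply: lin2; apply: leq_trans nN; apply: leq_addl.
  apply: leq_trans (_ : (2 ^ (n %/ 8)) ^ 8 <= _); last by rewrite -expnM leq_pexp2l // leq_trunc_div.
  apply: leq_trans (leq_pow2r 8 h48).
  have n1 : n.+1 <= 2 * n by move: n0; clear; lia.
  have n2 : (2 ^ k).+1 <= 2 * (n * n) by have := leq_mul n0 n0; move: Mn; clear; lia.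
  rewrite -mulnA -mulnA; apply: leq_trans (leq_mul (leqnn 3) (leq_mul (leq_pow2r 2 n1) (leq_mul (leq_pow2r 2 n2) Mn))) _.
  have -> : 3 * ((2 * n) ^ 2 * ((2 * (n * n)) ^ 2 * (n * n))) = 48 * n ^ 8.
    by rewrite !expnS expn0 !muln1; clear; lia.
  by rewrite expnMn leq_mul2r [48 ^ 8]expnS leq_pmulr ?orbT // expn_gt0.
split=> //.
have [l en] : exists l, n = k + l by exists (n - k); rewrite subnKC.
have -> : n - k = l by rewrite en addKn.
have kk0 : k0 <= k by move: ik hi; clear; lia.
have n2k : 2 * n <= 2 ^ k.
  apply: leq_trans (_ : 2 * 2 ^ i.+1 <= _); first by rewrite leq_mul2l ltnW ?orbT.
  by rewrite -expnS leq_pexp2l //; move: ik; clear; lia.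
subst n; have := few k l kk0 cond hke big.
move: #|_| => f hf; rewrite -(@leq_pmul2l 2) // mulnCA; apply: leq_trans hf.
by rewrite leq_mul2l n2k orbT.
Qed.

(** All points found lie within [D / e] of the first one. *)
Lemma count_spread (p : pred nat) a b e D :
  (forall x y, x \in iota a b -> y \in iota a b -> p x -> p y -> x <= y -> e * (y - x) <= D) ->
  e * count p (iota a b) <= D + e.
Proof.
move=> h; rewrite -size_filter; set s := filter p (iota a b).
have ss : sorted ltn s by apply: sorted_filter; [apply: ltn_trans | apply: iota_ltn_sorted].
case es : s => [|x s']; first by rewrite muln0.
have inS y : y \in s -> p y /\ y \in iota a b by rewrite mem_filter => /andP[].
have [px xi] : p x /\ x \in iota a b by apply: inS; rewrite es mem_head.
have [->|e0] := posnP e; first by rewrite mul0n.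
have sub : {subset s <= iota x (D %/ e).+1}.
  move=> y ys; have [py yi] := inS y ys.
  have xy : x <= y.
    move: ss ys; rewrite es /= (path_sortedE ltn_trans) => /andP[/allP h' _].
    by rewrite inE => /orP[/eqP -> //|/h']; apply: ltnW.
  rewrite mem_iota xy /= addnS ltnS -leq_subLR leq_divRL // mulnC.
  exact: h.
have := uniq_leq_size (sorted_uniq ltn_trans ltnn ss) sub; rewrite size_iota es.
move=> /(leq_mul (leqnn e))/leq_trans; apply.
by rewrite mulnS addnC leq_add2r mulnC leq_trunc_div.
Qed.

(** On a dyadic block [ilog n = i] is constant and the power of two just above [n i] takes at most
    three values. For each value, [n i] lies below that power by a factor [1 - O(1 / e)] at most,
    which confines [n] to an interval of length [O(2 ^ i / e)]. *)
Lemma near_power_block e i : 2 <= e <= i ->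
  e * count (near_power e) (iota (2 ^ i) (2 ^ i)) <= 30 * 2 ^ i + 3 * e.
Proof.
case/andP => e2 ei.
have i0 : 0 < i by rewrite (leq_trans _ ei) // ltnW.
have inB n : n \in iota (2 ^ i) (2 ^ i) -> [/\ 2 ^ i <= n, n < 2 ^ i.+1 & ilog n = i].
  rewrite mem_iota addnn -mul2n -expnS => /andP[h1 h2]; split=> //.
  by apply: trunc_log_eq; rewrite // h1.
pose t := ilog (2 ^ i * i).
have /andP[t1 t2] : 2 ^ t <= 2 ^ i * i < 2 ^ t.+1 by apply: ilogP; rewrite muln_gt0 expn_gt0.
pose j n := (ilog (n * ilog n)).+1.
have jP n : n \in iota (2 ^ i) (2 ^ i) -> n * i < 2 ^ j n.
  move=> /inB[h1 h2 e3]; rewrite /j e3.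
  have ni : 0 < n * i by rewrite muln_gt0 i0 andbT (leq_trans _ h1) // expn_gt0.
  by case/andP: (ilogP ni).
pose pj m n := near_power e n && (j n == t + m).
have three : count (near_power e) (iota (2 ^ i) (2 ^ i)) <=
    count (pj 1) (iota (2 ^ i) (2 ^ i)) + count (pj 2) (iota (2 ^ i) (2 ^ i)) +
    count (pj 3) (iota (2 ^ i) (2 ^ i)).
  have cE (a : pred nat) s : count a s = \sum_(x <- s) (a x : nat).
    by rewrite -sum1_count big_mkcond; apply: eq_bigr => x _; case: (a x).
  rewrite !cE -!big_split /= big_seq [X in _ <= X]big_seq; apply: leq_sum => n nI.
  rewrite /pj; have [nn|//] := boolP (near_power e n).
  have [n1 n2 en] := inB n nI; have nj := jP n nI.
  have tj : t < j n.
    rewrite -(ltn_exp2l _ _ (ltnSn 1)) (leq_ltn_trans t1) // (leq_ltn_trans _ nj) //.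
    by rewrite leq_mul2r n1 orbT.
  have jt : j n < t + 4.
    rewrite -(ltn_exp2l _ _ (ltnSn 1)).
    move: nn; rewrite /near_power -/(j n) en => nn.
    have b1 : (e + 2) * n * i.+1 <= e * (4 * (n * i)).
      have h : (e + 2) * i.+1 <= 2 * e * (2 * i) by apply: leq_mul; move: e2 i0; clear; lia.
      by have := leq_mul (leqnn n) h; clear; lia.
    have e0 : 0 < e by rewrite ltnW.
    have b2 : 2 ^ j n < 4 * (n * i) by rewrite -(ltn_pmul2l e0) (leq_trans nn).
    apply: leq_trans b2 _; rewrite addn4 expnS expnS expnS.
    have b3 : n * i <= 2 * (2 ^ i * i) by rewrite mulnA -expnS leq_mul2r ltnW ?orbT.
    by move: b3 t2; clear; lia.
  have : (j n == t + 1) || (j n == t + 2) || (j n == t + 3) by move: tj jt; clear; lia.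
  by case: (j n == t + 1); case: (j n == t + 2); case: (j n == t + 3).
have spread m : e * count (pj m) (iota (2 ^ i) (2 ^ i)) <= 10 * 2 ^ i + e.
  apply: count_spread => x y xi yi /andP[nx /eqP jx] /andP[ny /eqP jy] xy.
  have [x1 x2 ix] := inB x xi; have yP := jP y yi; rewrite jy -jx in yP.
  move: nx; rewrite /near_power -/(j x) ix => nx.
  have : e * (y * i) < (e + 2) * x * i.+1 by apply: leq_ltn_trans nx; rewrite leq_mul2l ltnW ?orbT.
  have ex : e * x <= i * x by rewrite leq_mul2r ei orbT.
  move=> key; rewrite mulnBr leq_subLR -(leq_pmul2r i0).
  have xi2 : x * i <= 2 * 2 ^ i * i by rewrite leq_mul2r -expnS ltnW ?orbT.
  have xi1 : x <= x * i by rewrite leq_pmulr.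
  by move: key ex xi1 xi2; rewrite !mulnDl !mulnS; clear; lia.
apply: leq_trans (leq_mul (leqnn e) three) _; rewrite !mulnDr.
apply: leq_trans (leq_add (leq_add (spread 1) (spread 2)) (spread 3)) _.
by clear; lia.
Qed.

Lemma near_power_count e : 2 <= e -> exists N, forall x, N <= x ->
  e * count (near_power e) (iota 1 x) <= 61 * x.
Proof.
move=> e2.
(* Blocks with [i < e] are counted trivially, at most [2 ^ e] integers in all; the others add up
   geometrically. *)
have total I : e * count (near_power e) (iota 1 (2 ^ I - 1)) <= e * 2 ^ e + 30 * 2 ^ I + 3 * e * I.
  elim: I => [|I IHI]; first by rewrite expn0 subnn /= !muln0.
  have -> : 2 ^ I.+1 - 1 = (2 ^ I - 1) + 2 ^ I.
    by have := expn_gt0 2 I; rewrite expnS; move: (2 ^ I) => a; clear; lia.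
  rewrite iotaD count_cat mulnDr [1 + _]subnKC ?expn_gt0 //.
  have [eI|Ie] := leqP e I.
    have := near_power_block (introT andP (conj e2 eI)).
    by move: IHI; rewrite expnS mulnS; clear; lia.
  have small : count (near_power e) (iota 1 (2 ^ I - 1)) + count (near_power e) (iota (2 ^ I) (2 ^ I)) <= 2 ^ e.
    apply: leq_trans (leq_add (count_size _ _) (count_size _ _)) _; rewrite !size_iota.
    apply: leq_trans (_ : 2 ^ I.+1 <= _); last by rewrite leq_pexp2l.
    by rewrite expnS mul2n -addnn leq_add2r leq_subr.
  by move: (leq_mul (leqnn e) small); rewrite mulnDr -!addnA; move=> h; apply: leq_trans h (leq_addr _ _).
have [m1 lin] := @linear_leq_exp (6 * e) 1 isT.
exists (2 ^ m1 + 2 * (e * 2 ^ e) + 6 * e) => x hx.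
have x0 : 0 < x by apply: leq_trans hx; rewrite -addnA addn_gt0 expn_gt0.
have /andP[x1 x2] := ilogP x0; set I := ilog x in x1 x2.
have m1I : m1 <= I.
  rewrite -ltnS -(ltn_exp2l _ _ (ltnSn 1)); apply: leq_ltn_trans x2.
  by apply: leq_trans hx; rewrite -addnA leq_addr.
have lI := lin I m1I; rewrite divn1 in lI.
have cx : count (near_power e) (iota 1 x) <= count (near_power e) (iota 1 (2 ^ I.+1 - 1)).
  have -> : 2 ^ I.+1 - 1 = x + (2 ^ I.+1 - 1 - x) by move: x2; clear; lia.
  by rewrite iotaD count_cat leq_addr.
apply: leq_trans (leq_mul (leqnn e) cx) (leq_trans (total _) _).
rewrite expnS mulnS; move: hx x1 lI; move: (e * 2 ^ e) (2 ^ I) (2 ^ m1) => a b c.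
rewrite -!mulnA; move: (e * I) => d; clear; lia.
Qed.

From mathcomp Require Import lra.
From mathcomp Require Import all_classical all_reals all_analysis.

Import numFieldNormedType.Exports.

Local Open Scope classical_set_scope.
Local Open Scope ring_scope.

(** * The limit along a set of density one *)

Section Probability.
Variable R : realType.

Lemma half_Pr (T : finType) (E : pred {set T}) :
  random_subset_Pr (2^-1 : R) E = #|[set A : {set T} | E A]%SET|%:R / 2 ^+ #|T|.
Proof.
rewrite /random_subset_Pr; under eq_bigr => A _.
  rewrite /random_subset_mass (eq_bigr (fun=> 2^-1 : R)); last first.
    by move=> x _; case: ifP => // _; lra.
  rewrite prodr_const cardT -cardT; over.
rewrite sumr_const exprVn mulr_natl; congr (_ *+ _).
by rewrite cardsE.
Qed.

Lemma half_Pr_ge (T : finType) (E : pred {set T}) (m : nat) : (0 < m)%N ->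
  (#|[set A : {set T} | ~~ E A]%SET| * m <= 2 ^ #|T|)%N ->
  1 - m%:R^-1 <= random_subset_Pr (2^-1 : R) E <= 1.
Proof.
move=> m0 h; rewrite half_Pr.
have c : (#|[set A : {set T} | E A]%SET| + #|[set A : {set T} | ~~ E A]%SET| = 2 ^ #|T|)%N.
  have -> : [set A : {set T} | ~~ E A]%SET = (~: [set A : {set T} | E A])%SET by apply/setP => A; rewrite !inE.
  by rewrite cardsC -cardsT -powersetT card_powerset cardsT.
have T0 : (0 : R) < 2 ^+ #|T| by rewrite exprn_gt0.
have m0R : (0 : R) < m%:R by rewrite ltr0n.
rewrite ler_pdivlMr // ler_pdivrMr // mul1r -natrX -c natrD.
rewrite lerDl ler0n andbT mulrBl mul1r -natrD c lerBlDr -c natrD.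
rewrite lerD2l ler_pdivlMl // -natrD c -natrM ler_nat mulnC; exact: h.
Qed.

Lemma log2_ge (y : R) (m : nat) : 0 < y -> (m%:R <= log2 y) = (2 ^+ m <= y).
Proof.
move=> y0; have l2 : (0 : R) < ln 2 by rewrite ln_gt0 // ltr1n.
rewrite /log2 ler_pdivlMr // -[X in _ = X]ler_ln ?posrE ?exprn_gt0 //.
by rewrite lnXn // mulr_natl.
Qed.

Lemma log2M (x y : R) : 0 < x -> 0 < y -> log2 (x * y) = log2 x + log2 y.
Proof. by move=> x0 y0; rewrite /log2 lnM ?posrE // mulrDl. Qed.

(** The sum is [log (n log n)], and [ilog n <= log n < ilog n + 1]; [n >= 16] keeps the floor
    nonnegative. *)
Lemma floor_loglog (n : nat) : (16 <= n)%N -> exists k : nat,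
  [/\ Num.floor (log2 (n%:R : R) + log2 (log2 (n%:R : R))) = k%:Z,
   (n * ilog n < 2 ^ k.+1)%N & (2 ^ k <= n * (ilog n).+1)%N].
Proof.
move=> n16; have n0 : (0 < n)%N by apply: leq_trans n16.
have nR : (0 : R) < n%:R by rewrite ltr0n.
set L := log2 (n%:R : R); set i := ilog n.
have /andP[i1 i2] := ilogP n0.
have Li : (i%:R : R) <= L by rewrite log2_ge // -natrX ler_nat.
have iL : L < (i.+1)%:R by rewrite ltNge log2_ge // -natrX ler_nat -ltnNge.
have i4 : (4 <= i)%N by rewrite -ltnS -(ltn_exp2l _ _ (ltnSn 1)); apply: leq_ltn_trans i2.
have L1 : (1 : R) <= L by apply: le_trans Li; rewrite ler1n (leq_trans _ i4).
have L0 : (0 : R) < L by apply: lt_le_trans L1.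
have nL0 : (0 : R) < n%:R * L by rewrite mulr_gt0.
have -> : L + log2 L = log2 (n%:R * L).
  by rewrite log2M.
have f0 : 0 <= Num.floor (log2 (n%:R * L)).
  by rewrite floor_ge0 (log2_ge 0) // expr0 mulr_ege1 // ler1n.
case ef : (Num.floor (log2 (n%:R * L))) f0 => [k|//] _; exists k; split=> //.
- have := lt_succ_floor (log2 (n%:R * L)); rewrite ef.
  rewrite (_ : (k%:Z + 1)%:~R = (k.+1)%:R :> R); last by rewrite -addn1 natrD intrD.
  rewrite ltNge log2_ge // -ltNge => h; rewrite -(ltr_nat R) natrX natrM.
  by apply: le_lt_trans h; rewrite ler_pM2l.
- have := floor_le (log2 (n%:R * L)); rewrite ef -[_%:~R]/(k%:R) log2_ge // => h.
  rewrite -(ler_nat R) natrX natrM; apply: le_trans h _.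
  by rewrite ler_pM2l // ltW.
Qed.

Definition good_event (n : nat) (A : {set 'rV['F_2]_n}) : bool :=
  (chromatic_number (cayley_sum_graph A))%:R ==
    (2 : R) ^ (n%:Z - Num.floor (log2 (n%:R : R) + log2 (log2 (n%:R : R)))).

Lemma good_event_Pr (e : nat) : exists N : nat, forall n, (N <= n)%N -> ~~ near_power e n ->
  1 - n%:R^-1 <= random_subset_Pr (2^-1 : R) (@good_event n) <= 1.
Proof.
have [N few] := few_exceptions_near e; exists (N + 16)%N => n nN near.
have n16 : (16 <= n)%N by apply: leq_trans nN; rewrite leq_addl.
have [k [fk h1 h2]] := floor_loglog n16.
have [kn hf] := few n k (leq_trans (leq_addr _ _) nN) h1 h2 near.
apply: half_Pr_ge; first exact: leq_trans n16.
rewrite card_mx card_Fp2 mul1n; apply: leq_trans hf; rewrite leq_mul2r; apply/orP; right.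
apply/subset_leq_card/fintype.subsetP => A; rewrite !finset.in_set /good_event fk.
apply: contra => /eqP ->; by rewrite subzn // -exprnP natrX.
Qed.
End Probability.

(** * Enumeration and diagonal choice of the good integers *)

Lemma enumerate_pred (S : pred nat) : (forall m, exists n, (m < n)%N && S n) ->
  (forall n, S n -> (0 < n)%N) ->
  exists u : nat -> nat, [/\ forall l, (l < u l)%N, forall l m, (l < m)%N -> (u l < u m)%N,
    forall l, S (u l) & forall n, S n -> exists l, u l = n].
Proof.
(* The enumeration starts at the least element above 0, which misses nothing since all elements are
   positive. *)
move=> inf pos; pose nxt m := ex_minn (inf m).
have nxtP m : [/\ (m < nxt m)%N, S (nxt m) & forall n, (m < n)%N -> S n -> (nxt m <= n)%N].
  rewrite /nxt; case: ex_minnP => p /andP[mp Sp] pmin; split=> // n mn Sn.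
  by apply: pmin; rewrite mn.
pose u l := iter l.+1 nxt 0%N.
have uS l : u l.+1 = nxt (u l) by [].
have mono : forall l m, (l < m)%N -> (u l < u m)%N.
  move=> l m; apply: (@homo_ltn _ u (fun a b => a < b)%N) => [? ? ?|l0]; first exact: ltn_trans.
  by rewrite uS; case: (nxtP (u l0)).
have ul l : (l < u l)%N.
  elim: l => [|l IHl]; first by case: (nxtP 0%N).
  exact: leq_ltn_trans IHl (mono l l.+1 (ltnSn l)).
exists u; split=> // [l|n Sn]; first by case: (nxtP (iter l nxt 0%N)).
suff h l : (n < u l)%N -> exists l', u l' = n by apply: (h n).
elim: l => [|l IHl] nu.
  have [_ _ /(_ n (pos n Sn) Sn)] := nxtP 0%N; rewrite leqNgt => /negP[]; exact: nu.
have [lt|] := ltnP n (u l); first exact: IHl.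
rewrite leq_eqVlt => /orP[/eqP <-|lt]; first by exists l.
have [_ _ /(_ n lt Sn)] := nxtP (u l); rewrite leqNgt => /negP[]; exact: nu.
Qed.

(** With [a] the power of two and [b = n (ilog n + 1)], the condition reads [e (a - b) < 2 b]. *)
Lemma near_power_mono e e' n : (e <= e')%N -> near_power e' n -> near_power e n.
Proof.
rewrite /near_power -!mulnA; move: (2 ^ _)%N (n * (ilog n).+1)%N => a b ee h.
have [ab|ba] := leqP a b; first by nia.
nia.
Qed.

(** The largest [e <= n] whose threshold [N e] has been reached, and 0 if there is none. *)
Definition emax (N : nat -> nat) (n : nat) : nat := \max_(e < n.+1 | (N e <= n)%N) e.

Lemma emax_geq N n e : (e <= n)%N -> (N e <= n)%N -> (e <= emax N n)%N.
Proof.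
move=> en Ne; have h : (e < n.+1)%N by [].
exact: (leq_bigmax_cond (Ordinal h) (P := fun e : 'I_n.+1 => (N e <= n)%N) (F := fun e => e : nat)).
Qed.

Lemma emaxP N n : (N 0%N <= n)%N -> (N (emax N n) <= n)%N.
Proof.
move=> N0; have [|i iP e] := @eq_bigmax_cond _ [pred e : 'I_n.+1 | (N e <= n)%N] (fun e => e : nat).
  by apply/card_gt0P; exists ord0.
by rewrite /emax e.
Qed.

Lemma sub_count_in (T : eqType) (p q : pred T) (s : seq T) :
  {in s, forall x, p x -> q x} -> (count p s <= count q s)%N.
Proof.
elim: s => //= x s IHs h; apply: leq_add.
  by have := h x (mem_head x s); case: (p x) => // ->.
by apply: IHs => y ys; apply: h; rewrite inE ys orbT.
Qed.

(* The threshold [e] grows slowly with [n], so that the exceptional set is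
   eventually contained in [near_power E] for every fixed [E]. *)
Lemma diagonal_set (N : nat -> nat) : let S n := (0 < n)%N && ~~ near_power (emax N n) n in
  forall E, (2 <= E)%N -> exists K, forall x,
    (E * count (predC S) (iota 1 x) <= K + 61 * x)%N.
Proof.
move=> S E E2; have [N2 cnt] := near_power_count E2.
pose K0 := maxn (N E) E; exists (E * (K0 + N2))%N => x.
have [xN|Nx] := leqP N2 x; last first.
  apply: leq_trans (leq_addr _ _); rewrite leq_mul2l; apply/orP; right.
  apply: leq_trans (count_size _ _) _; rewrite size_iota; lia.
apply: leq_trans (_ : E * (K0 + count (near_power E) (iota 1 x)) <= _)%N; last first.
  by rewrite !mulnDr; have := cnt x xN; lia.
rewrite leq_mul2l; apply/orP; right.
have [xK|Kx] := leqP x K0.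
  by apply: leq_trans (count_size _ _) _; rewrite size_iota; apply: leq_trans xK (leq_addr _ _).
have -> : x = (K0 + (x - K0))%N by rewrite subnKC // ltnW.
rewrite iotaD !count_cat addnA; apply: leq_add.
  by apply: leq_trans (count_size _ _) _; rewrite size_iota leq_addr.
apply: sub_count_in => n; rewrite mem_iota add1n => /andP[n1 _].
rewrite /= /S negb_and negbK -eqn0Ngt => /orP[/eqP n0|]; first by rewrite n0 in n1.
apply: near_power_mono; apply: emax_geq; apply: leq_trans (ltnW n1); rewrite /K0.
  exact: leq_maxr.
exact: leq_maxl.
Qed.

Theorem theorem1p4 (R : realType) :
  exists u : nat -> nat,
    [/\ forall l : nat, (0 < u l)%N,
        forall l m : nat, (l < m)%N -> (u l < u m)%N,
        has_density (range u) (1 : R) &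
        (fun l : nat =>
           random_subset_Pr (2^-1 : R)
             (fun A : {set 'rV['F_2]_(u l)} =>
                (chromatic_number (cayley_sum_graph A))%:R ==
                (2 : R) ^ ((u l)%:Z -
                           Num.floor (log2 ((u l)%:R : R) +
                                      log2 (log2 ((u l)%:R : R))))))
          @ \oo --> (1 : R)].
Proof.
have [N NP] := choice (good_event_Pr R).
pose S n := (0 < n)%N && ~~ near_power (emax N n) n.
have dens E (E2 : (2 <= E)%N) := diagonal_set N E2; rewrite -/S in dens.
have inf m : exists n, (m < n)%N && S n.
  (* With [122 = 2 * 61], at most half of the integers up to [x] are exceptional, up to a constant,
     so they cannot fill the whole range from [m + 1] to [x]. *)
  have [K hK] := dens 122 isT; pose x := (2 * m + K).+1.
  have : has S (iota m.+1 (x - m)).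
    rewrite -[has _ _]negbK -all_predC; apply/negP; rewrite all_count size_iota => /eqP c.
    have := hK x; rewrite (_ : x = m + (x - m))%N; last by rewrite /x; lia.
    by rewrite iotaD count_cat add1n [count _ (iota m.+1 _)]c /x; lia.
  by case/hasP => n; rewrite mem_iota => /andP[mn _] Sn; exists n; rewrite mn.
have [u [lu mono uS uE]] := enumerate_pred inf (fun n => fun h : S n => proj1 (andP h)).
exists u; split=> //.
- by move=> l; apply: leq_ltn_trans (lu l).
- rewrite /has_density; have rg k : (k \in range u) = S k.
    apply/idP/idP => [/set_mem[l _ <-] //|/uE[l <-]].
    by apply/mem_set; exists l.
  apply/cvgrPdist_le => eps eps0.
  (* The exceptional proportion is at most [(K / x + 61) / E <= 122 / E] for [x >= K]; adding 2
     ensures [2 <= E]. *)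
  pose E := (Num.bound (122 / eps)).+2.
  have [K hK] := dens E isT.
  exists ((2 * K).+1) => // x /= Kx.
  rewrite (eq_count rg).
  have c : (count S (iota 1 x) + count (predC S) (iota 1 x) = x)%N.
    by rewrite count_predC size_iota.
  have x0 : (0 : R) < x%:R by rewrite ltr0n; apply: leq_trans Kx.
  have E0 : (0 : R) < E%:R by rewrite ltr0n.
  have big : (122 / eps : R) <= E%:R.
    apply: le_trans (ltW (archi_boundP (ltW _))) _; first by rewrite divr_gt0.
    by rewrite ler_nat /E; lia.
  have cR : (count S (iota 1 x))%:R + (count (predC S) (iota 1 x))%:R = x%:R :> R by rewrite -natrD c.
  have hR : E%:R * (count (predC S) (iota 1 x))%:R <= K%:R + 61%:R * x%:R :> R.
    by rewrite -!natrM -natrD ler_nat.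
  rewrite -[X in `|X - _|](divff (lt0r_neq0 x0)) -mulrBl -{1}cR addrAC subrr add0r.
  rewrite ger0_norm; last by rewrite divr_ge0.
  rewrite ler_pdivrMr // -(ler_pM2l E0).
  apply: le_trans hR _; apply: le_trans (_ : 122 * x%:R <= _).
    have : (K%:R : R) <= x%:R by rewrite ler_nat; lia.
    by lra.
  by rewrite mulrA ler_pM2r // -ler_pdivrMr.
- apply/cvgrPdist_le => eps eps0.
  (* As [l < u l], from this index on [N 0 <= u l], so [emax] picks a threshold already reached, and
     the failure probability [1 / u l] is at most [eps]. *)
  exists (maxn (N 0%N) (Num.bound eps^-1)) => // l /= hl.
  have lul := ltnW (lu l); set n := u l in lul *.
  have /andP[n0 near] := uS l; rewrite -/n in n0 near.
  have Nn : (N (emax N n) <= n)%N.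
    by apply: emaxP; apply: leq_trans lul; apply: leq_trans hl; apply: leq_maxl.
  have /andP[p1 p2] := NP (emax N n) n Nn near.
  rewrite -/(good_event R) ger0_norm; last by rewrite subr_ge0.
  rewrite lerBlDr; move: p1; rewrite lerBlDr => /le_trans; apply.
  rewrite addrC lerD2r invf_ple ?posrE ?ltr0n //.
  have := archi_boundP (ltW (_ : 0 < eps^-1)); rewrite invr_gt0 => /(_ eps0) /ltW/le_trans; apply.
  by rewrite ler_nat; apply: leq_trans lul; apply: leq_trans hl; apply: leq_maxr.
Qed.
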